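(* Let $\varphi\in L^1_{\mathrm{loc}}(\mathbb{R}_+)$. If $Q_\varphi\in\boldsymbol{S}_1$, then $\varphi\in X_1$. Furthermore, $\varphi\in L^1(0,\infty)$ and $$\operatorname{trace}Q_\varphi=\int_0^\infty\varphi(x)\,dx .$$
   Context: $\mathbb{R}_+=(0,\infty)$, and ''loc'' refers to compact subsets of $(0,\infty)$. For a locally integrable complex-valued function $\varphi$ on $\mathbb{R}_+$, the operator $Q_\varphi$ is defined on bounded functions $f$ with compact support in $\mathbb{R}_+$ by $(Q_\varphi f)(x)=\int_0^\infty\varphi(\max\{x,y\})f(y)\,dy$. Writing $Q_\varphi\in\boldsymbol{S}_1$ means that it extends to a bounded operator on $L^2(\mathbb{R}_+)$ belonging to the trace class $\boldsymbol{S}_1$. $X_1$ is the space of all measurable functions $\varphi$ on $\mathbb{R}_+$ such that $$\sum_{n\in\mathbb{Z}}2^{n/2}\Bigl(\int_{2^n}^{2^{n+1}}|\varphi(x)|^2dx\Bigr)^{1/2}<\infty .$$ *)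

(* Defs.v *)
From HB Require Import structures.
From mathcomp Require Import all_boot all_order all_algebra.
From mathcomp Require Export complex.
From mathcomp Require Import all_classical all_reals all_analysis.

Set Implicit Arguments.
Unset Strict Implicit.
Unset Printing Implicit Defensive.

Import Order.TTheory GRing.Theory Num.Theory.
Import numFieldNormedType.Exports.

Local Open Scope classical_set_scope.
Local Open Scope ring_scope.

(* A function on R_+ = (0, oo) is represented by a function on all of R whose
   values outside Rplus are irrelevant. *)

Section RplusFunctions.
Context {R : realType}.
Local Notation C := R[i].
Local Notation mu := (@lebesgue_measure R).
Local Notation normc := complex.ComplexField.Normc.normc.
Implicit Types (f g phi : R -> C).

Definition Rplus : set R := `]0%R, +oo[.

Definition cmeasurable f :=
  measurable_fun Rplus (fun x => complex.Re (f x)) /\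
  measurable_fun Rplus (fun x => complex.Im (f x)).

(* The complex integral over R_+; meaningful when f is integrable (Rintegral
   returns 0 on infinite or undefined integrals). *)
Definition cintegral f : C :=
  Complex (\int[mu]_(x in Rplus) complex.Re (f x))
          (\int[mu]_(x in Rplus) complex.Im (f x)).

Definition cL1 f :=
  mu.-integrable Rplus (fun x => (complex.Re (f x))%:E) /\
  mu.-integrable Rplus (fun x => (complex.Im (f x))%:E).

Definition cL1loc f :=
  locally_integrable Rplus (fun x => complex.Re (f x)) /\
  locally_integrable Rplus (fun x => complex.Im (f x)).

Definition X1 phi :=
  cmeasurable phi /\
  (\esum_(n in [set: int])
     ((2 `^ (n%:~R / 2))%:E *
      (\int[mu]_(x in `[(2 : R) ^ n, (2 : R) ^ (n + 1)])
         ((normc (phi x)) ^+ 2)%:E) `^ 2^-1) < +oo)%E.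

(* L^2(R_+) is handled through representatives: elements are functions, and
   equality in L^2 is equality almost everywhere on R_+. *)

Definition L2 f :=
  cmeasurable f /\
  (\int[mu]_(x in Rplus) ((normc (f x)) ^+ 2)%:E < +oo)%E.

Definition eqL2 f g := ae_eq mu Rplus f g.

Definition L2norm f : R :=
  Num.sqrt (\int[mu]_(x in Rplus) ((normc (f x)) ^+ 2)).

Definition L2dot f g : C := cintegral (fun x => f x * (conjc (g x))).

Implicit Types (T K : (R -> C) -> (R -> C)).

Definition op_bound T (M : R) :=
  0 <= M /\ forall f, L2 f -> L2norm (T f) <= M * L2norm f.

(* Linearity together with boundedness implies that T respects eqL2, hence
   induces a bounded linear operator on the quotient space. *)
Definition bounded_operator T :=
  [/\ forall f, L2 f -> L2 (T f),
      forall (a : C) f g, L2 f -> L2 g ->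
        eqL2 (T (fun x => a * f x + g x)) (fun x => a * T f x + T g x)
    & exists M, op_bound T M].

Definition op_norm T : R := inf [set M | op_bound T M].

Definition op_sub T K : (R -> C) -> (R -> C) := fun f x => T f x - K f x.

Definition rank_le (n : nat) K :=
  exists2 g : 'I_n -> R -> C, (forall i, L2 (g i)) &
    forall f, L2 f -> exists c : 'I_n -> C,
      eqL2 (K f) (fun x => \sum_(i < n) c i * g i x).

(* The singular values s_n(T) = inf { ||T - K|| : rank K <= n }, n >= 0. *)
Definition singular_value T (n : nat) : R :=
  inf [set op_norm (op_sub T K) | K in
         [set K | bounded_operator K /\ rank_le n K]].

Definition trace_class T :=
  bounded_operator T /\
  (\sum_(0 <= n <oo) (singular_value T n)%:E < +oo)%E.

Definition orthonormal_basis (e : nat -> R -> C) :=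
  [/\ forall n, L2 (e n),
      forall m n, L2dot (e m) (e n) = (m == n)%:R
    & forall f, L2 f -> (forall n, L2dot f (e n) = 0) ->
        eqL2 f (fun=> 0)].

Definition cseries_cvg (u : nat -> C) (t : C) :=
  series (fun n => complex.Re (u n)) @ \oo --> complex.Re t /\
  series (fun n => complex.Im (u n)) @ \oo --> complex.Im t.

(* t is the trace of T: sum_n <T e_n, e_n> = t in every orthonormal basis. *)
Definition is_trace T (t : C) :=
  forall e, orthonormal_basis e ->
    cseries_cvg (fun n => L2dot (T (e n)) (e n)) t.

Definition bounded_compact_support f :=
  [/\ cmeasurable f,
      exists M : R, forall x, Rplus x -> normc (f x) <= M
    & exists K : set R,
        [/\ compact K, K `<=` Rplus &
            forall x, Rplus x -> ~ K x -> f x = 0]].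

Definition Q_op phi f : R -> C :=
  fun x => cintegral (fun y => phi (Num.max x y) * f y).

Definition extends_Q phi T :=
  bounded_operator T /\
  forall f, bounded_compact_support f -> eqL2 (T f) (Q_op phi f).

End RplusFunctions.

(* Main.v *)
Require Import Defs.
From HB Require Import structures.
From mathcomp Require Import all_boot all_order all_algebra complex.
From mathcomp Require Import all_classical all_reals all_analysis.
From mathcomp Require Import measurable_realfun ring lra.

(** Trace sums. Say that two families [a] and [b] in the unit ball, each made of
    pairwise orthogonal vectors, test an operator [D] through the sum of the
    numbers [<D a_i, b_i>]. If [D] has rank at most [m] and norm at most [c],
    such a sum is at most [m * c] ([finite_rank_trace_le]): expand [D] into [m]
    rank-one terms by Gram-Schmidt and use Bessel's inequality twice. A trace
    class operator [T] has approximants of rank [2 ^ j.+1] at distance about the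
    singular value of that index; consecutive ones differ by an operator whose
    rank times norm is summable, by Cauchy condensation, so that [T] is
    approximated uniformly with respect to all trace sums ([trace_class_tail]).
    Two consequences follow. All trace sums of [T] are bounded by one constant
    ([trace_class_sum_bounded]). And if the operators sending [f] to the sum of
    the [<f, b_i> a_i] tend strongly to the identity, the trace sums of [T]
    have a limit that does not depend on the families used
    ([approx_trace_unique]), because this holds for operators of finite rank.
    The partial sums of an orthonormal basis are of this kind, by completeness
    of L2 ([orthonormal_basis_approx_identity]).

    The kernel. Where [y < x], the kernel [phi (max x y)] equals [phi x]. Hence
    the operator sends the indicator function of an interval to a multiple of
    [phi] on everything to the right of that interval ([T_block]). All test
    families below consist of functions on an interval, paired with functions on
    the interval that follows it, so the diagonal is never met.

    - For consecutive dyadic intervals, with the restrictions of [phi] to them as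
      test vectors, the trace sums are the partial sums of the series that
      defines [X1], up to a constant factor ([L2dot_T_dyadic]).
    - For consecutive cells of a fine partition, averaging over a cell and placing
      the result on the previous one is an approximation of the identity, by
      Lebesgue differentiation ([shift_approx_identity]), and the trace sums are
      the integrals of [phi] over intervals that exhaust the half-line
      ([L2dot_T_shift]). Inserting the sign of the real or of the imaginary part
      of [phi], the uniform bound shows that [phi] is integrable. Without signs,
      the trace sums tend to the integral of [phi], and by uniqueness so do the
      partial sums along any orthonormal basis. *)

Set Implicit Arguments.
Unset Strict Implicit.
Unset Printing Implicit Defensive.

Import Order.TTheory GRing.Theory Num.Theory.
Import numFieldNormedType.Exports.

Local Open Scope classical_set_scope.
Local Open Scope ring_scope.

(** * Complex numbers *)

Section ComplexNumbers.
Context {R : realType}.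
Local Notation C := R[i].
Local Notation normc := complex.ComplexField.Normc.normc.
Implicit Types z w : C.

Lemma sqr_normcE z : normc z ^+ 2 = complex.Re z ^+ 2 + complex.Im z ^+ 2.
Proof. by case: z => a b /=; rewrite sqr_sqrtr ?addr_ge0 ?sqr_ge0. Qed.

Lemma normc_ge0 z : 0 <= normc z.
Proof. by case: z => a b /=; exact: sqrtr_ge0. Qed.

Lemma Re_add z w : complex.Re (z + w) = complex.Re z + complex.Re w.
Proof. by case: z w => a b []. Qed.

Lemma Im_add z w : complex.Im (z + w) = complex.Im z + complex.Im w.
Proof. by case: z w => a b []. Qed.

Lemma Re_sub z w : complex.Re (z - w) = complex.Re z - complex.Re w.
Proof. by case: z w => a b []. Qed.

Lemma Im_sub z w : complex.Im (z - w) = complex.Im z - complex.Im w.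
Proof. by case: z w => a b []. Qed.

Lemma Re_mul z w : complex.Re (z * w) =
  complex.Re z * complex.Re w - complex.Im z * complex.Im w.
Proof. by case: z w => a b []. Qed.

Lemma Im_mul z w : complex.Im (z * w) =
  complex.Re z * complex.Im w + complex.Im z * complex.Re w.
Proof. by case: z w => a b []. Qed.

Lemma Re_conjc z : complex.Re (conjc z) = complex.Re z. Proof. by case: z. Qed.
Lemma Im_conjc z : complex.Im (conjc z) = - complex.Im z. Proof. by case: z. Qed.

Lemma complex_ext z w : complex.Re z = complex.Re w ->
  complex.Im z = complex.Im w -> z = w.
Proof. by case: z w => a b [c d] /= -> ->. Qed.

Lemma normc_conj z : normc (conjc z) = normc z.
Proof. by case: z => a b /=; rewrite sqrrN. Qed.

Lemma mulcJ z : z * conjc z = (normc z ^+ 2)%:C%C.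
Proof.
by apply: complex_ext; rewrite ?Re_mul ?Im_mul Re_conjc Im_conjc ?sqr_normcE /=; ring.
Qed.

Lemma Re_sum (I : Type) (s : seq I) (F : I -> C) :
  complex.Re (\sum_(i <- s) F i) = \sum_(i <- s) complex.Re (F i).
Proof. by elim/big_ind2 : _ => // x a y b <- <-; rewrite Re_add. Qed.

Lemma Im_sum (I : Type) (s : seq I) (F : I -> C) :
  complex.Im (\sum_(i <- s) F i) = \sum_(i <- s) complex.Im (F i).
Proof. by elim/big_ind2 : _ => // x a y b <- <-; rewrite Im_add. Qed.

Lemma normc_sum (I : Type) (s : seq I) (F : I -> C) :
  normc (\sum_(i <- s) F i) <= \sum_(i <- s) normc (F i).
Proof.
elim/big_ind2 : _ => [|x a y b xa yb|//].
  by rewrite complex.ComplexField.Normc.normc0.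
by rewrite (le_trans (le_normcD _ _))// lerD.
Qed.

Lemma normc_Re z : `|complex.Re z| <= normc z.
Proof.
case: z => a b /=; rewrite -sqrtr_sqr ler_wsqrtr//.
by rewrite lerDl sqr_ge0.
Qed.

Lemma normc_Im z : `|complex.Im z| <= normc z.
Proof.
case: z => a b /=; rewrite -sqrtr_sqr ler_wsqrtr//.
by rewrite lerDr sqr_ge0.
Qed.

Lemma normc_le_ReIm z : normc z <= `|complex.Re z| + `|complex.Im z|.
Proof.
rewrite -(@ler_pXn2r _ 2)// ?nnegrE ?normc_ge0 ?addr_ge0//.
rewrite sqr_normcE sqrrD !real_normK ?num_real// -addrA lerD2l lerDr.
by rewrite mulrn_wge0// mulr_ge0.
Qed.

Lemma normcr (x : R) : normc x%:C%C = `|x|.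
Proof. by rewrite /= expr0n addr0 sqrtr_sqr. Qed.

End ComplexNumbers.

(* Simplification would otherwise expose the two components of an inner product
   under a conjugation. *)
#[local] Arguments conjc : simpl never.
#[local] Arguments cintegral : simpl never.
#[local] Arguments L2dot : simpl never.

(** * Square-integrable functions and their inner product *)

Section L2Functions.
Context {R : realType}.
Local Notation C := R[i].
Local Notation mu := (@lebesgue_measure R).
Local Notation normc := complex.ComplexField.Normc.normc.
Implicit Types (f g h : R -> C) (z w : C).

Lemma mRplus : measurable (Rplus : set (measurableTypeR R)).
Proof. exact: measurable_itv. Qed.

Lemma cmeasurable_lin a f g : cmeasurable f -> cmeasurable g ->
  cmeasurable (fun x => a * f x + g x).
Proof.
move=> [f1 f2] [g1 g2]; split.
  under eq_fun do rewrite Re_add Re_mul.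
  by apply: measurable_funD => //; apply: measurable_funB;
    apply: measurable_funM.
under eq_fun do rewrite Im_add Im_mul.
by apply: measurable_funD => //; apply: measurable_funD;
  apply: measurable_funM.
Qed.

Lemma cmeasurable_mul f g : cmeasurable f -> cmeasurable g ->
  cmeasurable (fun x => f x * g x).
Proof.
move=> [f1 f2] [g1 g2]; split.
  under eq_fun do rewrite Re_mul.
  by apply: measurable_funB; apply: measurable_funM.
under eq_fun do rewrite Im_mul.
by apply: measurable_funD; apply: measurable_funM.
Qed.

Lemma cmeasurable_conj f : cmeasurable f -> cmeasurable (fun x => conjc (f x)).
Proof.
move=> [f1 f2]; split.
  by under eq_fun do rewrite Re_conjc.
by under eq_fun do rewrite Im_conjc; exact: measurable_funN.
Qed.

Lemma cmeasurable_sqnorm f : cmeasurable f ->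
  measurable_fun Rplus (fun x => normc (f x) ^+ 2).
Proof.
move=> [f1 f2]; under eq_fun do rewrite sqr_normcE.
by apply: measurable_funD; exact: measurable_funX.
Qed.

Lemma L2P f : L2 f <-> cmeasurable f /\
  mu.-integrable Rplus (fun x => (normc (f x) ^+ 2)%:E).
Proof.
split=> -[mf fi]; split => //.
  apply/integrableP; split.
    by apply/measurable_EFinP; exact: cmeasurable_sqnorm.
  by under eq_integral do rewrite gee0_abs ?lee_fin ?sqr_ge0//.
move/integrableP : fi => [_].
by under eq_integral do rewrite gee0_abs ?lee_fin ?sqr_ge0//.
Qed.

Lemma L2_cmeasurable f : L2 f -> cmeasurable f. Proof. by case. Qed.

Lemma L2_integrable f : L2 f ->
  mu.-integrable Rplus (fun x => (normc (f x) ^+ 2)%:E).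
Proof. by move/L2P => []. Qed.

Lemma le_L2 f (b : R -> R) : cmeasurable f ->
  mu.-integrable Rplus (EFin \o b) ->
  (forall x, Rplus x -> normc (f x) ^+ 2 <= b x) -> L2 f.
Proof.
move=> mf ib fb; apply/L2P; split => //.
apply: le_integrable ib => //; first exact: mRplus.
  by apply/measurable_EFinP; exact: cmeasurable_sqnorm.
move=> x px; rewrite /= lee_fin ger0_norm ?sqr_ge0//.
by rewrite (le_trans (fb x px))// ler_norm.
Qed.

Lemma cmeasurable0 : @cmeasurable R (fun=> 0).
Proof. by split; exact: measurable_cst. Qed.

Lemma L2_0 : @L2 R (fun=> 0).
Proof.
apply: (@le_L2 _ (cst 0)); first exact: cmeasurable0.
  exact: integrable0.
by move=> x _; rewrite complex.ComplexField.Normc.normc0 expr0n.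
Qed.

Lemma sqr_normcD_le z w :
  normc (z + w) ^+ 2 <= 2 * (normc z ^+ 2 + normc w ^+ 2).
Proof.
rewrite !sqr_normcE Re_add Im_add.
have := sqr_ge0 (complex.Re z - complex.Re w).
have := sqr_ge0 (complex.Im z - complex.Im w).
by nra.
Qed.

Lemma L2_lin a f g : L2 f -> L2 g -> L2 (fun x => a * f x + g x).
Proof.
move=> Lf Lg.
apply: (@le_L2 _ (fun x => 2 * (normc a ^+ 2 * normc (f x) ^+ 2 +
   normc (g x) ^+ 2))).
- by apply: cmeasurable_lin; [case: Lf|case: Lg].
- have -> : EFin \o (fun x => 2 * (normc a ^+ 2 * normc (f x) ^+ 2 +
     normc (g x) ^+ 2)) = (fun x => (2%:E * ((normc a ^+ 2)%:E *
       (normc (f x) ^+ 2)%:E + (normc (g x) ^+ 2)%:E))%E).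
    by apply/funext => x /=; rewrite EFinM EFinD EFinM.
  apply: integrableZl; first exact: mRplus.
  apply: integrableD; [exact: mRplus| |exact: L2_integrable].
  by apply: integrableZl; [exact: mRplus|exact: L2_integrable].
- move=> x _; rewrite (le_trans (sqr_normcD_le _ _))//.
  by rewrite complex.ComplexField.Normc.normcM exprMn.
Qed.

Lemma L2_scale a f : L2 f -> L2 (fun x => a * f x).
Proof.
move=> Lf; have := L2_lin a Lf L2_0.
by under eq_fun do rewrite addr0.
Qed.

Lemma L2_add f g : L2 f -> L2 g -> L2 (fun x => f x + g x).
Proof.
by move=> Lf Lg; have := L2_lin 1 Lf Lg; under eq_fun do rewrite mul1r.
Qed.

Lemma L2_sub f g : L2 f -> L2 g -> L2 (fun x => f x - g x).
Proof.
move=> Lf Lg; have := L2_lin (-1) Lg Lf.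
by under eq_fun do rewrite mulN1r addrC.
Qed.

Lemma L2_sum (I : Type) (s : seq I) (F : I -> R -> C) :
  (forall i, L2 (F i)) -> L2 (fun x => \sum_(i <- s) F i x).
Proof.
move=> LF; elim: s => [|i s IH].
  by under eq_fun do rewrite big_nil; exact: L2_0.
by under eq_fun do rewrite big_cons; exact: L2_add.
Qed.

Lemma L2_comb (I : Type) (s : seq I) (c : I -> C) (F : I -> R -> C) :
  (forall i, L2 (F i)) -> L2 (fun x => \sum_(i <- s) c i * F i x).
Proof. by move=> LF; apply: L2_sum => i; exact: L2_scale. Qed.

Lemma cL1_le f (b : R -> R) : cmeasurable f ->
  mu.-integrable Rplus (EFin \o b) ->
  (forall x, Rplus x -> normc (f x) <= b x) -> cL1 f.
Proof.
move=> [m1 m2] ib fb; split; apply: le_integrable ib => //.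
- exact: mRplus.
- exact/measurable_EFinP.
- move=> x px /=; rewrite lee_fin (le_trans (normc_Re _))//.
  by rewrite (le_trans (fb _ px))// ler_norm.
- exact: mRplus.
- exact/measurable_EFinP.
- move=> x px /=; rewrite lee_fin (le_trans (normc_Im _))//.
  by rewrite (le_trans (fb _ px))// ler_norm.
Qed.

Lemma L2dot_cL1 f g : L2 f -> L2 g -> cL1 (fun x => f x * conjc (g x)).
Proof.
move=> Lf Lg.
apply: (@cL1_le _ (fun x => normc (f x) ^+ 2 + normc (g x) ^+ 2)).
- by apply: cmeasurable_mul; [case: Lf|apply: cmeasurable_conj; case: Lg].
- have := integrableD mRplus (L2_integrable Lf) (L2_integrable Lg).
  by apply: eq_integrable => [|x _]; [exact: mRplus|].
- move=> x _; rewrite complex.ComplexField.Normc.normcM normc_conj.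
  have := sqr_ge0 (normc (f x) - normc (g x)).
  have := normc_ge0 (f x); have := normc_ge0 (g x).
  by nra.
Qed.

Lemma integrable_lin (b : R) (u v : R -> R) :
  mu.-integrable Rplus (EFin \o u) -> mu.-integrable Rplus (EFin \o v) ->
  mu.-integrable Rplus (EFin \o (fun x => b * u x + v x)).
Proof.
move=> iu iv.
have := integrableD mRplus (integrableZl mRplus b iu) iv.
by apply: eq_integrable => [|x _]; [exact: mRplus|].
Qed.

Lemma Rintegral_lin (b : R) (u v : R -> R) :
  mu.-integrable Rplus (EFin \o u) -> mu.-integrable Rplus (EFin \o v) ->
  \int[mu]_(x in Rplus) (b * u x + v x) =
  b * (\int[mu]_(x in Rplus) u x) + \int[mu]_(x in Rplus) v x.
Proof.
move=> iu iv; rewrite RintegralD//; [|exact: mRplus|].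
  by rewrite RintegralZl//; exact: mRplus.
have := integrableZl mRplus b iu.
by apply: eq_integrable => [|x _]; [exact: mRplus|].
Qed.

Lemma cintegral_lin a f g : cL1 f -> cL1 g ->
  cintegral (fun x => a * f x + g x) = a * cintegral f + cintegral g.
Proof.
move=> [f1 f2] [g1 g2].
rewrite /cintegral; apply: complex_ext => /=.
  under eq_Rintegral do rewrite Re_add Re_mul -mulNr -addrA.
  by rewrite Re_add Re_mul /= !Rintegral_lin// ?mulNr ?addrA//; exact: integrable_lin.
under eq_Rintegral do rewrite Im_add Im_mul -addrA.
by rewrite Im_add Im_mul /= !Rintegral_lin// ?addrA//; exact: integrable_lin.
Qed.

Lemma cintegral_conj f : cL1 f ->
  cintegral (fun x => conjc (f x)) = conjc (cintegral f).
Proof.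
move=> [f1 f2]; apply: complex_ext; rewrite ?Re_conjc ?Im_conjc /=.
  by apply: eq_Rintegral => x _; rewrite Re_conjc.
rewrite -mulN1r -RintegralZl//; last exact: mRplus.
by apply: eq_Rintegral => x _; rewrite Im_conjc mulN1r.
Qed.

Lemma L2dot_linl a f g h : L2 f -> L2 g -> L2 h ->
  L2dot (fun x => a * f x + g x) h = a * L2dot f h + L2dot g h.
Proof.
move=> Lf Lg Lh; rewrite /L2dot -cintegral_lin; [|exact: L2dot_cL1..].
by congr cintegral; apply/funext => x; ring.
Qed.

Lemma L2dotC f g : L2 f -> L2 g -> L2dot g f = conjc (L2dot f g).
Proof.
move=> Lf Lg; rewrite /L2dot -cintegral_conj; last exact: L2dot_cL1.
by congr cintegral; apply/funext => x; rewrite rmorphM/= conjcK mulrC.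
Qed.

Lemma L2dot0l f : L2dot (fun=> 0) f = 0.
Proof.
rewrite /L2dot /cintegral.
under eq_Rintegral do rewrite mul0r /=.
under [X in Complex _ X]eq_Rintegral do rewrite mul0r /=.
by rewrite Rintegral_cst ?mul0r//; exact: mRplus.
Qed.

Lemma L2dotZl a f h : L2 f -> L2 h ->
  L2dot (fun x => a * f x) h = a * L2dot f h.
Proof.
move=> Lf Lh; have := L2dot_linl a Lf L2_0 Lh.
by under eq_fun do rewrite addr0; rewrite L2dot0l addr0.
Qed.

Lemma L2dotDl f g h : L2 f -> L2 g -> L2 h ->
  L2dot (fun x => f x + g x) h = L2dot f h + L2dot g h.
Proof.
move=> Lf Lg Lh; have := L2dot_linl 1 Lf Lg Lh.
by under eq_fun do rewrite mul1r; rewrite mul1r.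
Qed.

Lemma L2dotBl f g h : L2 f -> L2 g -> L2 h ->
  L2dot (fun x => f x - g x) h = L2dot f h - L2dot g h.
Proof.
move=> Lf Lg Lh; have := L2dot_linl (-1) Lg Lf Lh.
by under eq_fun do rewrite mulN1r addrC; rewrite mulN1r addrC.
Qed.

Lemma L2dot_suml (I : Type) (s : seq I) (F : I -> R -> C) h :
  (forall i, L2 (F i)) -> L2 h ->
  L2dot (fun x => \sum_(i <- s) F i x) h = \sum_(i <- s) L2dot (F i) h.
Proof.
move=> LF Lh; elim: s => [|i s IH].
  by rewrite big_nil; under eq_fun do rewrite big_nil; exact: L2dot0l.
rewrite big_cons -IH; under eq_fun do rewrite big_cons.
by rewrite L2dotDl//; exact: L2_sum.
Qed.

Lemma L2dot_combl (I : Type) (s : seq I) (c : I -> C) (F : I -> R -> C) h :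
  (forall i, L2 (F i)) -> L2 h ->
  L2dot (fun x => \sum_(i <- s) c i * F i x) h =
  \sum_(i <- s) c i * L2dot (F i) h.
Proof.
move=> LF Lh; rewrite L2dot_suml//; last by move=> i; exact: L2_scale.
by apply: eq_bigr => i _; rewrite L2dotZl.
Qed.

Lemma L2dot_combr (I : Type) (s : seq I) (c : I -> C) (F : I -> R -> C) h :
  (forall i, L2 (F i)) -> L2 h ->
  L2dot h (fun x => \sum_(i <- s) c i * F i x) =
  \sum_(i <- s) conjc (c i) * L2dot h (F i).
Proof.
move=> LF Lh; rewrite L2dotC//; last exact: L2_comb.
rewrite L2dot_combl// rmorph_sum; apply: eq_bigr => i _ /=.
by rewrite rmorphM/= -L2dotC.
Qed.

Lemma L2dotZr a f h : L2 f -> L2 h ->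
  L2dot h (fun x => a * f x) = conjc a * L2dot h f.
Proof.
move=> Lf Lh; rewrite L2dotC//; last exact: L2_scale.
by rewrite L2dotZl// rmorphM/= -L2dotC.
Qed.

Lemma L2norm_ge0 f : 0 <= L2norm f.
Proof. exact: sqrtr_ge0. Qed.

Lemma sqr_L2norm f :
  L2norm f ^+ 2 = \int[mu]_(x in Rplus) (normc (f x) ^+ 2).
Proof.
by rewrite sqr_sqrtr//; apply: Rintegral_ge0 => x _; rewrite sqr_ge0.
Qed.

Lemma L2dotff f : L2dot f f = (L2norm f ^+ 2)%:C%C.
Proof.
rewrite sqr_L2norm /L2dot /cintegral; apply: complex_ext => /=.
  by apply: eq_Rintegral => x _; rewrite mulcJ.
under eq_Rintegral do rewrite mulcJ /=.
by rewrite Rintegral_cst ?mul0r//; exact: mRplus.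
Qed.

Lemma sqr_L2normE f : L2 f ->
  (L2norm f ^+ 2)%:E = (\int[mu]_(x in Rplus) (normc (f x) ^+ 2)%:E)%E.
Proof.
move=> Lf; rewrite sqr_L2norm /Rintegral fineK//.
exact: (integrable_fin_num mRplus (L2_integrable Lf)).
Qed.

Lemma eqL2_cst0P f : L2 f -> L2norm f = 0 <-> eqL2 f (fun=> 0).
Proof.
move=> Lf; have mf := L2_cmeasurable Lf.
have mf2 : measurable_fun Rplus (fun x => (normc (f x) ^+ 2)%:E).
  by apply/measurable_EFinP; exact: cmeasurable_sqnorm.
have H := @ae_eq_integral_abs _ _ _ mu _ mRplus _ mf2.
have E0 : (\int[mu]_(x in Rplus) `|(normc (f x) ^+ 2)%:E| =
   (L2norm f ^+ 2)%:E)%E.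
  rewrite sqr_L2normE//; apply: eq_integral => x _.
  by rewrite gee0_abs// lee_fin sqr_ge0.
rewrite E0 in H; split.
  move=> f0; have := (H.1 _); rewrite f0 expr0n => /(_ erefl).
  apply: filterS => x /[apply] /= -[] /eqP; rewrite sqrf_eq0 => /eqP.
  by move/complex.ComplexField.Normc.eq0_normc.
move=> f0; suff : (L2norm f ^+ 2)%:E = 0%E.
  by case=> /eqP; rewrite sqrf_eq0 => /eqP.
apply/H; move: f0; apply: filterS => x /[apply] /= ->.
by rewrite complex.ComplexField.Normc.normc0 expr0n.
Qed.

Lemma eqL2_sub0 f g : eqL2 f g -> eqL2 (fun x => f x - g x) (fun=> 0).
Proof. by apply: filterS => x /[apply] /= ->; rewrite subrr. Qed.

Lemma eqL2_sym f g : eqL2 f g -> eqL2 g f.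
Proof. by apply: filterS => x /[apply] /= ->. Qed.

Lemma eqL2_trans f g h : eqL2 f g -> eqL2 g h -> eqL2 f h.
Proof. by apply: filterS2 => x fg gh Dx; rewrite fg// gh. Qed.

Lemma eqL2_subP f g : L2 f -> L2 g ->
  L2norm (fun x => f x - g x) = 0 <-> eqL2 f g.
Proof.
move=> Lf Lg; split.
  move/(eqL2_cst0P (L2_sub Lf Lg)).
  by apply: filterS => x /[apply] /= /eqP; rewrite subr_eq0 => /eqP.
by move/eqL2_sub0/(eqL2_cst0P (L2_sub Lf Lg)).
Qed.

End L2Functions.

(** * Orthogonal families, bounded functionals *)

Section Hilbert.
Context {R : realType}.
Local Notation C := R[i].
Local Notation mu := (@lebesgue_measure R).
Local Notation normc := complex.ComplexField.Normc.normc.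
Implicit Types (f g h : R -> C) (z w : C).

Lemma sqr_L2normD f g : L2 f -> L2 g -> L2norm (fun x => f x + g x) ^+ 2 =
  L2norm f ^+ 2 + 2 * complex.Re (L2dot f g) + L2norm g ^+ 2.
Proof.
move=> Lf Lg; have Lfg := L2_add Lf Lg.
have E u : L2norm u ^+ 2 = complex.Re (L2dot u u) by rewrite L2dotff.
rewrite !E L2dotDl// (L2dotC Lfg Lf) (L2dotC Lfg Lg) !L2dotDl//.
by rewrite Re_add !Re_conjc !Re_add (L2dotC Lg Lf) Re_conjc; ring.
Qed.

Lemma sqr_L2normB f g : L2 f -> L2 g -> L2norm (fun x => f x - g x) ^+ 2 =
  L2norm f ^+ 2 - 2 * complex.Re (L2dot f g) + L2norm g ^+ 2.
Proof.
move=> Lf Lg; have Lfg := L2_sub Lf Lg.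
have E u : L2norm u ^+ 2 = complex.Re (L2dot u u) by rewrite L2dotff.
rewrite !E L2dotBl// (L2dotC Lfg Lf) (L2dotC Lfg Lg) !L2dotBl//.
by rewrite Re_sub !Re_conjc !Re_sub (L2dotC Lg Lf) Re_conjc; ring.
Qed.

Lemma L2normZ a f : L2 f -> L2norm (fun x => a * f x) = normc a * L2norm f.
Proof.
move=> Lf; apply/eqP; rewrite -(@eqrXn2 _ 2)// ?L2norm_ge0//; last first.
  by rewrite mulr_ge0 ?normc_ge0 ?L2norm_ge0.
apply/eqP; apply: complexI; rewrite -L2dotff L2dotZl//; last exact: L2_scale.
rewrite L2dotZr// L2dotff mulrA mulcJ exprMn.
by rewrite -rmorphM.
Qed.

(** Only an upper bound on the norms is required, so that the zero vector is
    allowed and any rescaling of an orthogonal family into the unit ball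
    qualifies: this is all that Bessel's inequality needs. *)
Definition orthocontractive (I : eqType) (e : I -> R -> C) :=
  [/\ forall i, L2 (e i), forall i j, i != j -> L2dot (e i) (e j) = 0
    & forall i, L2norm (e i) <= 1].

Section Bessel.
Variables (I : eqType) (e : I -> R -> C) (s : seq I).
Hypotheses (oc : orthocontractive e) (us : uniq s).

Let Le i : L2 (e i). Proof. by case: oc. Qed.

Lemma orthocontractive_dot i : i \in s -> forall c : I -> C,
  \sum_(j <- s) c j * L2dot (e j) (e i) = c i * (L2norm (e i) ^+ 2)%:C%C.
Proof.
move=> si c; rewrite (big_rem i)//= big1_seq ?addr0 ?L2dotff// => j /andP[_].
rewrite mem_rem_uniq// inE => /andP[ji _].
by case: oc => _ -> //; rewrite mulr0.
Qed.

Lemma sqr_L2norm_comb_le (c : I -> C) :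
  L2norm (fun x => \sum_(i <- s) c i * e i x) ^+ 2 <=
  \sum_(i <- s) normc (c i) ^+ 2.
Proof.
have -> : L2norm (fun x => \sum_(i <- s) c i * e i x) ^+ 2 =
    \sum_(i <- s) normc (c i) ^+ 2 * L2norm (e i) ^+ 2.
  apply: complexI; rewrite -L2dotff L2dot_combr//; last exact: L2_comb.
  rewrite rmorph_sum/= big_seq [RHS]big_seq; apply: eq_bigr => i si.
  rewrite L2dot_combl// orthocontractive_dot// mulrA [conjc _ * _]mulrC.
  by rewrite mulcJ -rmorphM.
apply: ler_sum => i _; rewrite ler_piMr ?sqr_ge0//.
by case: oc => _ _ /(_ i) e1; rewrite expr_le1 ?L2norm_ge0.
Qed.

Lemma Bessel f : L2 f ->
  \sum_(i <- s) normc (L2dot f (e i)) ^+ 2 <= L2norm f ^+ 2.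
Proof.
move=> Lf; set c := fun i => L2dot f (e i).
have Lh : L2 (fun x => \sum_(i <- s) c i * e i x) by exact: L2_comb.
have := sqr_ge0 (L2norm (fun x => f x - \sum_(i <- s) c i * e i x)).
rewrite sqr_L2normB// L2dot_combr//.
have -> : complex.Re (\sum_(i <- s) conjc (c i) * L2dot f (e i)) =
    \sum_(i <- s) normc (c i) ^+ 2.
  by rewrite Re_sum; apply: eq_bigr => i _; rewrite mulrC mulcJ.
have := sqr_L2norm_comb_le c.
set S := \sum_(i <- s) normc (c i) ^+ 2; rewrite /c -/S.
set N := L2norm _ ^+ 2; set M := L2norm _ ^+ 2.
by lra.
Qed.

End Bessel.

Lemma Cauchy_Schwarz f g : L2 f -> L2 g ->
  normc (L2dot f g) <= L2norm f * L2norm g.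
Proof.
move=> Lf Lg.
(* a vector of norm less than n, divided by n, is a one-element family to which
   Bessel's inequality applies; g itself may be null *)
have H n : L2norm g < n -> normc (L2dot f g) <= L2norm f * n.
  move=> gn; have n0 : 0 < n by rewrite (le_lt_trans (L2norm_ge0 g)).
  pose e (_ : unit) : R -> C := fun x => (n^-1)%:C%C * g x.
  have oc : orthocontractive e.
    split=> [?|[] []//|?]; first exact: L2_scale.
    rewrite L2normZ// normcr ger0_norm ?invr_ge0 ?(ltW n0)//.
    by rewrite ler_pdivrMl// mulr1 ltW.
  have := @Bessel _ e [:: tt] oc isT _ Lf.
  rewrite big_seq1 /e L2dotZr// complex.ComplexField.Normc.normcM.
  rewrite normc_conj normcr ger0_norm ?invr_ge0 ?(ltW n0)//.
  rewrite ler_pXn2r ?nnegrE ?mulr_ge0 ?normc_ge0 ?L2norm_ge0 ?invr_ge0 ?(ltW n0)//.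
  by rewrite ler_pdivrMl// [_ * n]mulrC.
have [f0|f0] := leP (L2norm f) 0.
  have := H (L2norm g + 1); rewrite ltrDl ltr01 => /(_ isT).
  have -> : L2norm f = 0 by apply/eqP; rewrite eq_le f0 L2norm_ge0.
  by rewrite !mul0r.
rewrite mulrC -ler_pdivrMr//; apply/ler_addgt0Pr => d d0.
by rewrite ler_pdivrMr// mulrC; apply: H; rewrite ltrDl.
Qed.

Lemma L2normD f g : L2 f -> L2 g ->
  L2norm (fun x => f x + g x) <= L2norm f + L2norm g.
Proof.
move=> Lf Lg; rewrite -(@ler_pXn2r _ 2)// ?nnegrE ?addr_ge0 ?L2norm_ge0//.
rewrite sqr_L2normD// sqrrD lerD2r lerD2l -[leRHS]mulr_natl ler_pM2l//.
rewrite (le_trans _ (Cauchy_Schwarz Lf Lg))// (le_trans (ler_norm _))//.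
exact: normc_Re.
Qed.

Lemma L2normN f : L2 f -> L2norm (fun x => - f x) = L2norm f.
Proof.
move=> Lf; have := L2normZ (-1) Lf; under eq_fun do rewrite mulN1r.
by rewrite normcN complex.ComplexField.Normc.normc1 mul1r.
Qed.

Lemma L2normB f g : L2 f -> L2 g ->
  L2norm (fun x => f x - g x) <= L2norm f + L2norm g.
Proof.
move=> Lf Lg; have L : L2 (fun x => - g x).
  by have := L2_scale (-1) Lg; under eq_fun do rewrite mulN1r.
by rewrite (le_trans (L2normD Lf L))// L2normN.
Qed.

Lemma L2norm_sub_trans f g h : L2 f -> L2 g -> L2 h ->
  L2norm (fun x => f x - h x) <=
  L2norm (fun x => f x - g x) + L2norm (fun x => g x - h x).
Proof.
move=> Lf Lg Lh; rewrite (le_trans _ (L2normD (L2_sub Lf Lg) (L2_sub Lg Lh)))//.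
by under [X in _ <= L2norm X]eq_fun do rewrite subrKA.
Qed.

Lemma L2dot_null f h : L2 f -> L2 h -> L2norm f = 0 -> L2dot f h = 0.
Proof.
move=> Lf Lh f0; apply: complex.ComplexField.Normc.eq0_normc.
apply/eqP; rewrite eq_le normc_ge0 andbT.
by have := Cauchy_Schwarz Lf Lh; rewrite f0 mul0r.
Qed.

Lemma eq_L2dotl f g h : L2 f -> L2 g -> L2 h -> eqL2 f g ->
  L2dot f h = L2dot g h.
Proof.
move=> Lf Lg Lh fg; apply/eqP; rewrite -subr_eq0 -L2dotBl//; apply/eqP.
by apply: L2dot_null => //; [exact: L2_sub|apply/eqL2_subP].
Qed.

Lemma eq_L2norm f g : L2 f -> L2 g -> eqL2 f g -> L2norm f = L2norm g.
Proof.
move=> Lf Lg fg; have H (u v : R -> C) : L2 u -> L2 v -> eqL2 u v -> L2norm u <= L2norm v.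
  move=> Lu Lv /(eqL2_subP Lu Lv) uv0.
  have := L2normD (L2_sub Lu Lv) Lv; rewrite uv0 add0r.
  by under eq_fun do rewrite subrK.
by apply/eqP; rewrite eq_le !H//; exact: eqL2_sym.
Qed.

Definition bounded_functional (l : (R -> C) -> C) (c : R) :=
  (forall a f g, L2 f -> L2 g -> l (fun x => a * f x + g x) = a * l f + l g) /\
  (forall f, L2 f -> normc (l f) <= c * L2norm f).

Section functional.
Variables (l : (R -> C) -> C) (c : R).
Hypothesis lc : bounded_functional l c.

Lemma functional0 : l (fun=> 0) = 0.
Proof.
have [+ _] := lc => /(_ (-1) _ _ (@L2_0 R) (@L2_0 R)).
by under eq_fun do rewrite mulr0 addr0; rewrite mulN1r addNr.
Qed.

Lemma functional_comb (I : Type) (s : seq I) (a : I -> C) (e : I -> R -> C) :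
  (forall i, L2 (e i)) ->
  l (fun x => \sum_(i <- s) a i * e i x) = \sum_(i <- s) a i * l (e i).
Proof.
move=> Le; elim: s => [|i s IH].
  by under eq_fun do rewrite big_nil; rewrite big_nil functional0.
under eq_fun do rewrite big_cons; rewrite big_cons -IH.
by case: lc => ->//; exact: L2_comb.
Qed.

Lemma functionalB f g : L2 f -> L2 g -> l (fun x => f x - g x) = l f - l g.
Proof.
move=> Lf Lg; have [+ _] := lc => /(_ (-1) _ _ Lg Lf).
by under eq_fun do rewrite mulN1r addrC; rewrite mulN1r addrC.
Qed.

(** The dual form of Bessel's inequality, obtained by testing the functional on
    the combination of the family with the conjugate values as coefficients. *)
Lemma Bessel_functional (I : eqType) (e : I -> R -> C) (s : seq I) :
  orthocontractive e -> uniq s ->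
  \sum_(i <- s) normc (l (e i)) ^+ 2 <= c ^+ 2.
Proof.
move=> oc us; have Le i : L2 (e i) by case: oc.
set S := \sum_(i <- s) _; set h := fun x => \sum_(i <- s) conjc (l (e i)) * e i x.
have S0 : 0 <= S by apply: sumr_ge0 => i _; rewrite sqr_ge0.
have lh : l h = S%:C%C.
  rewrite functional_comb// rmorph_sum; apply: eq_bigr => i _.
  by rewrite mulrC mulcJ.
have Sh : L2norm h ^+ 2 <= S.
  rewrite (le_trans (sqr_L2norm_comb_le oc us _))//.
  by apply: ler_sum => i _; rewrite normc_conj.
have : S <= c * L2norm h.
  case: lc => _ /(_ h); rewrite lh normcr ger0_norm//; apply.
  exact: L2_comb.
have [-> _|S1 Sch] := eqVneq S 0; first exact: sqr_ge0.
have {}S1 : 0 < S by rewrite lt_def S1.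
rewrite -(ler_pM2r S1) (@le_trans _ _ (c ^+ 2 * L2norm h ^+ 2))//; last first.
  by rewrite ler_wpM2l// sqr_ge0.
rewrite -expr2 -exprMn ler_pXn2r ?nnegrE//.
exact: le_trans Sch.
Qed.

End functional.

End Hilbert.

(** * Operators of finite rank *)

Section FiniteRank.
Context {R : realType}.
Local Notation C := R[i].
Local Notation mu := (@lebesgue_measure R).
Local Notation normc := complex.ComplexField.Normc.normc.
Implicit Types (f g h : R -> C) (z w : C).

Definition proj (m : nat) (e : nat -> R -> C) f : R -> C :=
  fun x => \sum_(0 <= j < m) L2dot f (e j) * e j x.

Lemma L2_proj m e f : (forall i, L2 (e i)) -> L2 (proj m e f).
Proof. by move=> Le; exact: L2_comb. Qed.

(** Gram-Schmidt without any independence assumption: a vector depending on the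
    previous ones contributes a null vector. *)
Lemma Gram_Schmidt m (g : nat -> R -> C) : (forall i, L2 (g i)) ->
  exists2 e : nat -> R -> C, orthocontractive e &
    forall i, (i < m)%N -> eqL2 (g i) (proj m e (g i)).
Proof.
move=> Lg.
suff [e [oce e01 _ ge]] : exists e : nat -> R -> C, [/\ orthocontractive e,
    forall j, L2norm (e j) = 0 \/ L2norm (e j) = 1,
    forall j, (m <= j)%N -> e j = (fun=> 0) &
    forall i, (i < m)%N -> eqL2 (g i) (proj m e (g i))] by exists e.
elim: m => [|m [e [oce e01 e0 ge]]].
  have n0 : L2norm (fun _ : R => 0 : C) = 0.
    by apply/eqL2_cst0P; [exact: L2_0|exact: aeW].
  exists (fun _ _ => 0); split => //.
  - split=> [_|i j _|_]; [exact: L2_0|exact: L2dot0l|by rewrite n0].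
  - by move=> _; left.
have [Le eperp e1] := oce.
pose r x := g m x - proj m e (g m) x.
have Lr : L2 r by apply: L2_sub => //; exact: L2_proj.
have re j : L2dot r (e j) = 0.
  have [jm|mj] := ltnP j m; last by rewrite e0// L2dotC ?L2dot0l ?rmorph0//;
    exact: L2_0.
  rewrite L2dotBl//; last exact: L2_proj.
  rewrite L2dot_combl// (orthocontractive_dot oce (iota_uniq _ _)); last first.
    by rewrite mem_index_iota.
  have [ej|ej] := e01 j; last by rewrite ej expr1n mulr1 subrr.
  by rewrite ej expr0n mulr0 subr0 L2dotC// L2dot_null// rmorph0.
have Lp f : L2 (proj m e f) by exact: L2_proj.
have pr f : L2dot (proj m e f) r = 0.
  rewrite L2dot_combl// big1// => j _.
  by rewrite (L2dotC Lr (Le j)) re rmorph0 mulr0.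
pose n := L2norm r; pose em x := (n^-1)%:C%C * r x.
have Lem : L2 em by exact: L2_scale.
pose e' j := if j == m then em else e j.
have Le' j : L2 (e' j) by rewrite /e'; case: ifP.
have projS f : L2 f -> proj m.+1 e' f =
    (fun x => proj m e f x + L2dot f em * em x).
  move=> Lf; apply/funext => x; rewrite /proj big_nat_recr//= /e' eqxx.
  congr (_ + _); apply: eq_big_nat => j /andP[_ jm].
  by rewrite ltn_eqF.
have eme j : L2dot em (e j) = 0 by rewrite L2dotZl// re mulr0.
have gem f : L2 f -> L2dot f em = (n^-1)%:C%C * L2dot f r.
  by move=> Lf; rewrite L2dotZr// conjc_real.
exists e'; split.
- split=> // [i j|j].
    rewrite /e'; case: (i =P m) => [->|_]; case: (j =P m) => [->|_] //.
    + by rewrite eqxx.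
    + by move=> _; rewrite L2dotC// eme rmorph0.
    + by move=> /eperp.
  rewrite /e'; case: ifP => // _; rewrite L2normZ// normcr ger0_norm; last first.
    by rewrite invr_ge0 L2norm_ge0.
  by have [->|n0] := eqVneq n 0; rewrite ?invr0 ?mul0r// mulVf.
- move=> j; rewrite /e'; case: ifP => // _.
  rewrite L2normZ// normcr ger0_norm ?invr_ge0 ?L2norm_ge0// -/n.
  have [->|n0] := eqVneq n 0; first by rewrite invr0 mul0r; left.
  by right; rewrite mulVf.
- by move=> j mj; rewrite /e' gtn_eqF// e0// ltnW.
- move=> i; rewrite ltnS leq_eqVlt projS// => /predU1P[->|im].
    have grr : L2dot (g m) r = (n ^+ 2)%:C%C.
      have := L2dotBl (Lg m) (Lp (g m)) Lr.
      by rewrite pr subr0 -/r L2dotff => <-.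
    have [n0|n0] := eqVneq n 0.
      move/(eqL2_cst0P Lr): n0; apply: filterS => x /[apply] rx0.
      by rewrite /em rx0 !mulr0 addr0; apply/eqP; rewrite -subr_eq0; apply/eqP.
    apply: aeW => x _; rewrite gem// grr /em mulrA -!rmorphM/= mulrAC.
    by rewrite -invfM -expr2 mulVf ?expf_neq0// mul1r /r addrC subrK.
  have := ge i im; apply: filterS => x /[apply] gx.
  rewrite {1}gx gem//; suff -> : L2dot (g i) r = 0 by rewrite mulr0 mul0r addr0.
  by rewrite (eq_L2dotl _ (Lp (g i)))//; exact: ge.
Qed.

(** Gram-Schmidt applied to the range: an operator of rank at most [m] is a sum
    of [m] rank-one operators whose coefficient functionals are controlled by
    the operator bound. *)
Lemma finite_rank_expansion (D : (R -> C) -> R -> C) c m :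
  bounded_operator D -> op_bound D c -> rank_le m D ->
  exists e : nat -> R -> C, [/\ orthocontractive e,
    forall j, bounded_functional (fun f => L2dot (D f) (e j)) c &
    forall f h, L2 f -> L2 h -> L2dot (D f) h =
      \sum_(0 <= j < m) L2dot (D f) (e j) * L2dot (e j) h].
Proof.
move=> [LD linD _] [c0 Dc] [g Lg Dg].
pose g' i := if insub i is Some j then g j else fun=> 0.
have Lg' i : L2 (g' i) by rewrite /g'; case: insubP => // *; exact: L2_0.
have [e oce ge] := Gram_Schmidt m Lg'.
have [Le _ e1] := oce.
exists e; split=> // [j|f h Lf Lh].
  split=> [a f h Lf Lh|f Lf].
    rewrite (eq_L2dotl _ _ _ (linD a f h Lf Lh))//.
    - by rewrite L2dot_linl//; exact: LD.
    - by apply: LD; exact: L2_lin.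
    - by apply: L2_lin; exact: LD.
  rewrite (le_trans (Cauchy_Schwarz (LD _ Lf) (Le j)))//.
  rewrite (le_trans _ (Dc _ Lf))// ler_piMr ?L2norm_ge0//.
have LDf := LD f Lf.
have Lp u : L2 (proj m e u) by exact: L2_proj.
suff Dproj : eqL2 (D f) (proj m e (D f)).
  by rewrite {1}(eq_L2dotl _ _ _ Dproj)// L2dot_combl.
have [a Dfa] := Dg f Lf.
pose u x := \sum_(i < m) a i * g i x.
have Lu : L2 u by exact: L2_comb.
have uu : eqL2 u (proj m e u).
  have gi (i : 'I_m) : g i = g' i by rewrite /g' valK.
  have /ae_foralln : forall n, ae_eq mu (fun x => (n < m)%N /\ Rplus x)
      (g' n) (proj m e (g' n)).
    move=> n; have [nm|mn] := ltnP n m; last by apply: aeW => x [].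
    by have := ge n nm; apply: filterS => x H [_ /H].
  apply: filterS => x gx px; rewrite /u /proj.
  under eq_bigr do rewrite gi gx ?ltn_ord// /proj mulr_sumr.
  rewrite exchange_big/=; apply: eq_bigr => j _.
  rewrite L2dot_combl// mulr_suml; apply: eq_bigr => i _.
  by rewrite gi mulrA.
apply: (eqL2_trans Dfa); apply: (eqL2_trans uu); apply: aeW => x _.
by apply: eq_bigr => j _; rewrite (eq_L2dotl Lu LDf (Le j) (eqL2_sym Dfa)).
Qed.

End FiniteRank.

(** * Trace sums of operators of finite rank *)

Section TraceSums.
Context {R : realType}.
Local Notation C := R[i].
Local Notation mu := (@lebesgue_measure R).
Local Notation normc := complex.ComplexField.Normc.normc.
Implicit Types (f g h : R -> C) (z w : C) (T K D : (R -> C) -> R -> C).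

Lemma sum_normc_le (I : eqType) (s : seq I) (p q : I -> C) (c : R) : 0 < c ->
  \sum_(i <- s) normc (p i) ^+ 2 <= c ^+ 2 ->
  \sum_(i <- s) normc (q i) ^+ 2 <= 1 ->
  normc (\sum_(i <- s) p i * q i) <= c.
Proof.
move=> c0 pc q1; rewrite (le_trans (normc_sum _ _))//.
(* arithmetic-geometric mean, weighted so that both halves come out as c / 2 *)
have H i : normc (p i * q i) <=
    (2 * c)^-1 * normc (p i) ^+ 2 + c / 2 * normc (q i) ^+ 2.
  rewrite complex.ComplexField.Normc.normcM.
  set x := normc (p i); set y := normc (q i).
  have := sqr_ge0 (x - c * y).
  have -> : (2 * c)^-1 * x ^+ 2 + c / 2 * y ^+ 2 =
      (x ^+ 2 + c ^+ 2 * y ^+ 2) / (2 * c) by field; lra.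
  by rewrite ler_pdivlMr ?mulr_gt0//; nra.
rewrite (le_trans (ler_sum _ (fun i _ => H i)))// big_split/= -!mulr_sumr.
rewrite [leRHS](_ : c = (2 * c)^-1 * c ^+ 2 + c / 2 * 1); last by field; lra.
by apply: lerD; apply: ler_wpM2l => //; rewrite ?invr_ge0; lra.
Qed.

(** Expanding the operator into [m] rank-one terms, each term is estimated by
    Bessel's inequality, once for the functional and once for the vector. *)
Lemma finite_rank_trace_le D c m (I : eqType) (a b : I -> R -> C) (s : seq I) :
  0 < c -> bounded_operator D -> op_bound D c -> rank_le m D ->
  orthocontractive a -> orthocontractive b -> uniq s ->
  normc (\sum_(i <- s) L2dot (D (a i)) (b i)) <= m%:R * c.
Proof.
move=> c0 bD Dc rD oa ob us.
have [e [[Le _ e1] lc De]] := finite_rank_expansion bD Dc rD.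
have La i : L2 (a i) by case: oa.
have Lb i : L2 (b i) by case: ob.
under eq_bigr do rewrite De//.
rewrite exchange_big/= (le_trans (normc_sum _ _))//.
rewrite (@le_trans _ _ (\sum_(0 <= j < m) c))//; last first.
  by rewrite big_const_nat iter_addr_0 subn0 mulr_natl.
apply: ler_sum => j _; apply: sum_normc_le => //.
  exact: (Bessel_functional (lc j)).
by rewrite (le_trans (Bessel ob us (Le j)))// expr_le1 ?L2norm_ge0.
Qed.

(** Both the partial sums of an orthonormal basis and averages over fine
    partitions are of this form; keeping the two families separate allows the
    averages to be taken over intervals disjoint from those carrying the
    result. *)
Definition approx_identity (a b : nat -> nat -> R -> C) (N : nat -> nat) :=
  [/\ forall n, orthocontractive (a n), forall n, orthocontractive (b n) &
    forall f, L2 f ->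
      L2norm (fun x => f x - \sum_(0 <= i < N n) L2dot f (b n i) * a n i x)
        @[n --> \oo] --> (0 : R)].

Definition approx_trace a b (N : nat -> nat) T n : C :=
  \sum_(0 <= i < N n) L2dot (T (a n i)) (b n i).

(** The limit is the trace of [D]: in each rank-one term the trace sum is the
    coefficient functional applied to an approximation of the vector. *)
Lemma finite_rank_trace_cvg D c m :
  bounded_operator D -> op_bound D c -> rank_le m D ->
  exists t : C, forall a b N, approx_identity a b N ->
    normc (approx_trace a b N D n - t) @[n --> \oo] --> (0 : R).
Proof.
move=> bD Dc rD.
have [e [[Le _ e1] lc De]] := finite_rank_expansion bD Dc rD.
exists (\sum_(0 <= j < m) L2dot (D (e j)) (e j)) => a b N [oa ob ab].
have La n i : L2 (a n i) by case: (oa n).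
have Lb n i : L2 (b n i) by case: (ob n).
pose A n j x := \sum_(0 <= i < N n) L2dot (e j) (b n i) * a n i x.
have LA n j : L2 (A n j) by exact: L2_comb.
have H n : normc (approx_trace a b N D n -
    \sum_(0 <= j < m) L2dot (D (e j)) (e j)) <=
    \sum_(0 <= j < m) c * L2norm (fun x => e j x - A n j x).
  rewrite /approx_trace; under eq_bigr do rewrite De//.
  rewrite exchange_big/= -sumrB (le_trans (normc_sum _ _))//.
  apply: ler_sum => j _; rewrite -normcN opprB.
  have -> : \sum_(0 <= i < N n) L2dot (D (a n i)) (e j) * L2dot (e j) (b n i) =
      L2dot (D (A n j)) (e j).
    rewrite (functional_comb (lc j) _ _ (La n)).
    by apply: eq_bigr => i _; rewrite mulrC.
  rewrite -(functionalB (lc j))//.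
  by case: (lc j) => _; apply; exact: L2_sub.
apply: (@squeeze_cvgr _ _ _ _ (fun=> 0) (fun n =>
  \sum_(0 <= j < m) c * L2norm (fun x => e j x - A n j x))).
- by apply: nearW => n; rewrite normc_ge0 H.
- exact: cvg_cst.
- have : (fun n => \sum_(0 <= j < m) c * L2norm (fun x => e j x - A n j x))
      @ \oo --> \sum_(0 <= j < m) c * 0.
    apply: (@cvg_big R nat +%R 0 xpredT add_continuous _ \oo) => j _.
    by apply: cvgM; [exact: cvg_cst|exact: ab].
  by rewrite big1// => j _; rewrite mulr0.
Qed.

End TraceSums.

(** * Approximation by operators of finite rank *)

Section Approximation.
Context {R : realType}.
Local Notation C := R[i].
Local Notation mu := (@lebesgue_measure R).
Local Notation normc := complex.ComplexField.Normc.normc.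
Implicit Types (f g h : R -> C) (z w : C) (T K D : (R -> C) -> R -> C).

Lemma op_bound_sub T K M M' : bounded_operator T -> bounded_operator K ->
  op_bound T M -> op_bound K M' -> op_bound (op_sub T K) (M + M').
Proof.
move=> [LT _ _] [LK _ _] [M0 TM] [M'0 KM]; split; first exact: addr_ge0.
move=> f Lf; rewrite (le_trans (L2normB (LT _ Lf) (LK _ Lf)))//.
by rewrite mulrDl lerD ?TM ?KM.
Qed.

Lemma bounded_operator_sub T K : bounded_operator T -> bounded_operator K ->
  bounded_operator (op_sub T K).
Proof.
move=> bT bK; have [LT linT [M TM]] := bT; have [LK linK [M' KM]] := bK.
split; last by exists (M + M'); exact: op_bound_sub.
  by move=> f Lf; apply: L2_sub; [exact: LT|exact: LK].
move=> a f g Lf Lg; have := linK a f g Lf Lg; have := linT a f g Lf Lg.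
by apply: filterS2 => x tx kx px; rewrite /op_sub tx// kx//; ring.
Qed.

Lemma op_bound_le T M M' : M <= M' -> op_bound T M -> op_bound T M'.
Proof.
move=> MM' [M0 TM]; split; first exact: le_trans MM'.
by move=> f Lf; rewrite (le_trans (TM _ Lf))// ler_wpM2r// L2norm_ge0.
Qed.

Lemma bounded_operator0 : bounded_operator (fun (_ : R -> C) (_ : R) => 0 : C).
Proof.
have n0 : L2norm (fun _ : R => 0 : C) = 0.
  by apply/eqL2_cst0P; [exact: L2_0|exact: aeW].
split; first by move=> *; exact: L2_0.
  by move=> a f g _ _; apply: aeW => x _; rewrite mulr0 addr0.
by exists 0; split => // f _; rewrite n0 mul0r.
Qed.

(** Indexing by natural numbers makes ranks easy to add and to enlarge. *)
Lemma rank_leP n K : rank_le n K <-> exists2 g : nat -> R -> C,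
  (forall i, L2 (g i)) & forall f, L2 f -> exists c : nat -> C,
    eqL2 (K f) (fun x => \sum_(0 <= i < n) c i * g i x).
Proof.
split=> -[g Lg Kg]; last first.
  exists (fun i : 'I_n => g i) => // f Lf; have [c Kc] := Kg f Lf.
  exists (fun i : 'I_n => c i).
  by apply: eqL2_trans Kc _; apply: aeW => x _; rewrite big_mkord.
exists (fun i => if insub i is Some j then g j else fun=> 0).
  by move=> i; case: insubP => // *; exact: L2_0.
move=> f Lf; have [c Kc] := Kg f Lf.
exists (fun i => if insub i is Some j then c j else 0).
apply: eqL2_trans Kc _; apply: aeW => x _; rewrite big_mkord.
by apply: eq_bigr => i _; rewrite valK.
Qed.

Lemma rank_le_mono n m K : (n <= m)%N -> rank_le n K -> rank_le m K.
Proof.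
move=> nm /rank_leP[g Lg Kg]; apply/rank_leP; exists g => // f Lf.
have [c Kc] := Kg f Lf; exists (fun i => if (i < n)%N then c i else 0).
apply: eqL2_trans Kc _; apply: aeW => x _.
rewrite [RHS](big_cat_nat _ nm)//= [X in _ + X]big_nat [X in _ + X]big1 ?addr0.
  by apply: eq_big_nat => i /andP[_ ->].
by move=> i /andP[ni _]; rewrite ltnNge ni mul0r.
Qed.

Lemma rank_le0 n : rank_le n (fun (_ : R -> C) (_ : R) => 0 : C).
Proof.
exists (fun _ _ => 0) => [_|f _]; first exact: L2_0.
by exists (fun=> 0); apply: aeW => x _; rewrite big1// => i _; rewrite mulr0.
Qed.

Lemma rank_le_sub n m K K' : rank_le n K -> rank_le m K' ->
  rank_le (n + m) (op_sub K K').
Proof.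
move=> /rank_leP[g Lg Kg] /rank_leP[g' Lg' Kg']; apply/rank_leP.
exists (fun i => if (i < n)%N then g i else g' (i - n)%N).
  by move=> i; case: ifP.
move=> f Lf; have [c Kc] := Kg f Lf; have [c' Kc'] := Kg' f Lf.
exists (fun i => if (i < n)%N then c i else - c' (i - n)%N).
move: Kc Kc'; apply: filterS2 => x Kx K'x px; rewrite /op_sub Kx// K'x//.
rewrite [RHS](big_cat_nat _ (leq_addr _ _))//=; congr (_ + _).
  by apply: eq_big_nat => i /andP[_ ->].
rewrite -[X in _ = \sum_(X <= _ < _) _]add0n big_addn addKn -sumrN.
by apply: eq_bigr => i _; rewrite ltnNge leq_addl/= addnK mulNr.
Qed.

Lemma op_norm_ge0 T : bounded_operator T -> 0 <= op_norm T.
Proof.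
move=> [_ _ [M TM]]; apply: lb_le_inf; first by exists M.
by move=> x [].
Qed.

Lemma singular_value_lbound T n : bounded_operator T ->
  lbound [set op_norm (op_sub T K) | K in
    [set K | bounded_operator K /\ rank_le n K]] 0.
Proof.
move=> bT _ [K [bK _]] <-; apply: op_norm_ge0; exact: bounded_operator_sub.
Qed.

Lemma singular_value_nonempty T n : [set op_norm (op_sub T K) | K in
    [set K | bounded_operator K /\ rank_le n K]] !=set0.
Proof.
exists (op_norm (op_sub T (fun _ _ => 0))); exists (fun _ _ => 0) => //.
by split; [exact: bounded_operator0|exact: rank_le0].
Qed.

Lemma singular_value_ge0 T n : bounded_operator T -> 0 <= singular_value T n.
Proof.
move=> bT; apply: lb_le_inf; first exact: singular_value_nonempty.
exact: singular_value_lbound.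
Qed.

Lemma singular_value_mono T n m : bounded_operator T -> (n <= m)%N ->
  singular_value T m <= singular_value T n.
Proof.
move=> bT nm; apply: lb_le_inf; first exact: singular_value_nonempty.
move=> _ [K [bK rK]] <-; apply: ge_inf.
  by exists 0; exact: singular_value_lbound.
by exists K => //; split => //; exact: rank_le_mono rK.
Qed.

Lemma singular_value_adherent T n d : bounded_operator T -> 0 < d ->
  exists K, [/\ bounded_operator K, rank_le n K &
    op_bound (op_sub T K) (singular_value T n + d)].
Proof.
move=> bT d0.
have hs : has_inf [set op_norm (op_sub T K) | K in
    [set K | bounded_operator K /\ rank_le n K]].
  split; first exact: singular_value_nonempty.
  by exists 0; exact: singular_value_lbound.
have [_ [K [bK rK] <-] Kd] := inf_adherent d0 hs.
exists K; split => //.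
have [_ _ [M0 TKM0]] := bounded_operator_sub bT bK.
have hM : has_inf [set M | op_bound (op_sub T K) M].
  by split; [exists M0|exists 0 => x []].
have e0 : 0 < singular_value T n + d - op_norm (op_sub T K).
  by rewrite subr_gt0.
have [M TKM] := inf_adherent e0 hM.
rewrite addrC subrK => MM; exact: op_bound_le (ltW MM) TKM.
Qed.

End Approximation.

(** * Trace sums of trace class operators *)

Section TraceClass.
Context {R : realType}.
Local Notation C := R[i].
Local Notation mu := (@lebesgue_measure R).
Local Notation normc := complex.ComplexField.Normc.normc.
Implicit Types (f g h : R -> C) (z w : C) (T K D : (R -> C) -> R -> C).

(** Cauchy condensation: by monotonicity, [2 ^ j * s (2 ^ j.+1)] is at most the
    sum of the [2 ^ j] terms that precede [s (2 ^ j.+1)]. *)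
Lemma condensation_le (s : nat -> R) (S : R) :
  (forall n m, (n <= m)%N -> s m <= s n) -> (forall n, 0 <= s n) ->
  (forall n, \sum_(0 <= i < n) s i <= S) ->
  forall J, \sum_(0 <= j < J) 2 ^+ j * s (2 ^ j.+1)%N <= S.
Proof.
move=> sm s0 sS J; apply: le_trans (sS (2 ^ J)%N).
apply: (@le_trans _ _ (\sum_(1 <= i < 2 ^ J) s i)); last first.
  by rewrite [leRHS]big_ltn ?expn_gt0// lerDr.
elim: J => [|J IH]; first by rewrite big_nil big_geq.
have J1 : (1 <= 2 ^ J)%N by rewrite expn_gt0.
have J2 : (2 ^ J <= 2 ^ J.+1)%N by rewrite leq_exp2l.
rewrite big_nat_recr//= (big_cat_nat J1 J2)/=.
rewrite lerD// (@le_trans _ _ (\sum_(2 ^ J <= i < 2 ^ J.+1) s (2 ^ J.+1)%N))//.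
  rewrite big_const_nat iter_addr_0 -[leRHS]mulr_natl expnS mul2n -addnn addnK.
  by rewrite natrX.
by apply: ler_sum_nat => i /andP[_ iJ]; apply: sm; exact: ltnW.
Qed.

(** The correction [4^-1 ^+ j] only makes room for the infimum in the definition
    of the singular values, which need not be attained. *)
Lemma trace_class_approximation T : trace_class T ->
  exists (K : nat -> (R -> C) -> R -> C) (d : nat -> R) (S : R),
  [/\ forall j, bounded_operator (K j) /\ rank_le (2 ^ j.+1) (K j),
      forall j, 0 < d j,
      forall j, op_bound (op_sub T (K j)) (d j) &
      forall J, \sum_(0 <= j < J) 2 ^+ j * d j <= S].
Proof.
move=> [bT sumT]; pose s := singular_value T.
pose d j : R := s (2 ^ j.+1)%N + 4^-1 ^+ j.
have HK j : {K | [/\ bounded_operator K, rank_le (2 ^ j.+1) K &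
    op_bound (op_sub T K) (d j)]}.
  by apply: cid; apply: singular_value_adherent => //; rewrite exprn_gt0.
have s0 n : 0 <= s n by exact: singular_value_ge0.
pose S := fine (\sum_(0 <= n <oo) (s n)%:E)%E.
have sS n : \sum_(0 <= i < n) s i <= S.
  rewrite -lee_fin -sumEFin /S fineK.
    by apply: nneseries_lim_ge => i _ _; rewrite lee_fin.
  by rewrite ge0_fin_numE//; apply: nneseries_ge0 => i _ _; rewrite lee_fin.
exists (fun j => sval (HK j)), d, (S + 2); split.
- by move=> j; case: (HK j) => K [].
- by move=> j; rewrite /d ltr_wpDl// exprn_gt0.
- by move=> j; case: (HK j) => K [].
move=> J; under eq_bigr do rewrite mulrDr; rewrite big_split/= lerD//.
  apply: condensation_le => // n m nm; exact: singular_value_mono.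
have := @geometric_le_lim R J 1 2^-1 ler01; rewrite /series/= /geometric/=.
under eq_bigr do rewrite mul1r.
have -> : \sum_(0 <= i < J) 2 ^+ i * 4^-1 ^+ i =
    \sum_(0 <= i < J) (2^-1 : R) ^+ i.
  by apply: eq_bigr => i _; rewrite -exprMn; congr (_ ^+ _); field.
move=> H; have : \sum_(0 <= i < J) (2^-1 : R) ^+ i <= 1 / (1 - 2^-1).
  by apply: H; [|rewrite ger0_norm]; lra.
by move/le_trans; apply; rewrite ler_pdivrMr; lra.
Qed.

(** The telescoping decomposition along the approximants of rank [2 ^ j.+1]: the
    [j]-th difference has rank [O(2 ^ j)] and norm [d j + d j.+1], so that its
    trace sums are summable, uniformly in the orthogonal families. *)
Lemma trace_class_tail T : trace_class T ->
  exists (K : nat -> (R -> C) -> R -> C) (eps : nat -> R),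
  [/\ forall j, bounded_operator (K j) /\ rank_le (2 ^ j.+1) (K j),
      eps @ \oo --> (0 : R) &
      forall j (I : eqType) (a b : I -> R -> C) (s : seq I),
        orthocontractive a -> orthocontractive b -> uniq s ->
        normc (\sum_(i <- s) L2dot (op_sub T (K j) (a i)) (b i)) <= eps j].
Proof.
move=> tT; have bT := tT.1.
have [K [d [S [bK d0 TK dS]]]] := trace_class_approximation tT.
(* the ranks 2 ^ j.+1 and 2 ^ j.+2 of two consecutive approximants add up to
   6 * 2 ^ j *)
pose E j := 6 * (2 ^+ j * d j + 2 ^+ j.+1 * d j.+1).
have F0 j : 0 < 2 ^+ j * d j by rewrite mulr_gt0// exprn_gt0.
have E0 j : 0 <= E j by rewrite mulr_ge0// addr_ge0// ltW.
have dE j : d j <= E j.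
  rewrite /E; have := F0 j.+1; have : d j <= 2 ^+ j * d j.
    by rewrite ler_peMl ?(ltW (d0 j))// exprn_ege1// ler1n.
  by have := d0 j; nra.
have cE : cvgn (series E).
  apply: nondecreasing_is_cvgn.
    by apply: nondecreasing_series => i _ _.
  exists (12 * S) => _ [J _ <-]; rewrite /series/= -mulr_sumr big_split/=.
  have := dS J; have := dS J.+1; rewrite big_nat_recl//=.
  by have := F0 0%N; lra.
have Ecvg0 : E @ \oo --> (0 : R) by exact: cvg_series_cvg_0.
exists K, (fun j => limn (series E) - series E j); split => //.
  rewrite -[X in _ --> X](subrr (limn (series E))).
  by apply: cvgB; [exact: cvg_cst|].
move=> j I a b s oa ob us.
have La i : L2 (a i) by case: oa.
have Lb i : L2 (b i) by case: ob.
have LK k f : L2 f -> L2 (K k f) by case: (bK k) => -[+ _ _] _; exact.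
have LT f : L2 f -> L2 (T f) by case: bT => + _ _; exact.
pose X k := \sum_(i <- s) L2dot (op_sub T (K k) (a i)) (b i).
have XS k : normc (X k) <= normc (X k.+1) + E k.
  have -> : X k = X k.+1 +
      \sum_(i <- s) L2dot (op_sub (K k.+1) (K k) (a i)) (b i).
    rewrite -big_split/=; apply: eq_bigr => i _.
    rewrite -L2dotDl//; try by apply: L2_sub; auto.
    by congr L2dot; apply/funext => x; rewrite /op_sub; ring.
  rewrite (le_trans (le_normcD _ _))// lerD2l.
  have bD : op_bound (op_sub (K k.+1) (K k)) (d k + d k.+1).
    have [d1 TK1] := TK k; have [d2 TK2] := TK k.+1.
    split; first exact: addr_ge0.
    move=> f Lf; rewrite mulrDl.
    rewrite (le_trans _ (lerD (TK1 f Lf) (TK2 f Lf)))//.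
    rewrite (le_trans _ (L2normB _ _))//; try by apply: L2_sub; auto.
    rewrite le_eqVlt; apply/orP; left; apply/eqP; congr L2norm.
    by apply/funext => x; rewrite /op_sub; ring.
  have rD := rank_le_sub (bK k.+1).2 (bK k).2.
  have := finite_rank_trace_le _ (bounded_operator_sub (bK _).1 (bK _).1) bD rD
    oa ob us.
  rewrite addr_gt0// => /(_ isT) /le_trans; apply.
  rewrite natrD !natrX /E !exprS.
  have := d0 k; have := d0 k.+1; have : 0 < 2 ^+ k :> R by rewrite exprn_gt0.
  by nra.
have Xj k : normc (X j) <= normc (X (j + k)%N) + (series E (j + k)%N - series E j).
  elim: k => [|k IH]; first by rewrite addn0 subrr addr0.
  rewrite (le_trans IH)//; have := XS (j + k)%N.
  by rewrite addnS seriesSr; lra.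
have X0 k : normc (X k) <= (size s)%:R * E k.
  rewrite (le_trans (normc_sum _ _))//.
  rewrite mulr_natl -iter_addr_0 -count_predT -big_const_seq.
  apply: ler_sum => i _.
  have LTK : L2 (op_sub T (K k) (a i)) by apply: L2_sub; auto.
  rewrite (le_trans (Cauchy_Schwarz LTK (Lb i)))//.
  have b1 : L2norm (b i) <= 1 by case: ob.
  have a1 : L2norm (a i) <= 1 by case: oa.
  have [dk TKk] := TK k; have {}TKk := TKk _ (La i).
  have := dE k; have := L2norm_ge0 (op_sub T (K k) (a i)).
  have := L2norm_ge0 (b i); have := L2norm_ge0 (a i).
  by nra.
apply/ler_addgt0Pr => e e0.
have : (fun k => (size s)%:R * E k) @ \oo --> (0 : R).
  by rewrite -(mulr0 (size s)%:R); apply: cvgM => //; exact: cvg_cst.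
move/cvgrPdist_le => /(_ e e0) [k _ /(_ (j + k)%N (leq_addl _ _))] /=.
rewrite sub0r normrN (ger0_norm (mulr_ge0 (ler0n _ _) (E0 _))) => ke.
rewrite (le_trans (Xj k))// addrC lerD ?(le_trans (X0 _) ke)// lerD2r.
apply: nondecreasing_cvgn_le => //.
by apply: nondecreasing_series => i _ _.
Qed.

Lemma trace_class_sum_bounded T : trace_class T -> exists B : R,
  forall (I : eqType) (a b : I -> R -> C) (s : seq I),
    orthocontractive a -> orthocontractive b -> uniq s ->
    normc (\sum_(i <- s) L2dot (T (a i)) (b i)) <= B.
Proof.
move=> tT; have [K [eps [bK _ TK]]] := trace_class_tail tT.
have [[LK _ [M KM]] rK] := bK 0%N.
have KM1 : op_bound (K 0%N) (M + 1) by apply: op_bound_le KM; rewrite lerDl.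
exists (eps 0%N + (2 ^ 1)%:R * (M + 1)) => I a b s oa ob us.
have La i : L2 (a i) by case: oa.
have Lb i : L2 (b i) by case: ob.
have LT f : L2 f -> L2 (T f) by case: tT => -[+ _ _ _]; exact.
have -> : \sum_(i <- s) L2dot (T (a i)) (b i) =
    \sum_(i <- s) L2dot (op_sub T (K 0%N) (a i)) (b i) +
    \sum_(i <- s) L2dot (K 0%N (a i)) (b i).
  rewrite -big_split/=; apply: eq_bigr => i _.
  by rewrite L2dotBl ?subrK//; auto.
rewrite (le_trans (le_normcD _ _))// lerD ?TK//.
apply: finite_rank_trace_le => //; last exact: (bK 0%N).1.
by rewrite ltr_pwDr//; case: KM.
Qed.

(** The trace is well defined: any two approximations of the identity compute
    the same limit, because they do so on each finite-rank approximant. *)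
Lemma approx_trace_unique T a b N a' b' N' : trace_class T ->
  approx_identity a b N -> approx_identity a' b' N' ->
  normc (approx_trace a b N T n - approx_trace a' b' N' T n)
    @[n --> \oo] --> (0 : R).
Proof.
move=> tT ab ab'; have [K [eps [bK eps0 TK]]] := trace_class_tail tT.
have LT f : L2 f -> L2 (T f) by case: tT => -[+ _ _ _]; exact.
have LK j f : L2 f -> L2 (K j f) by case: (bK j) => -[+ _ _] _; exact.
apply/cvgrPdist_le => e e0.
have e4 : 0 < e / 4 by rewrite divr_gt0.
move/cvgrPdist_le : eps0 => /(_ _ e4) [j _ /(_ j (leqnn _))] /=.
rewrite sub0r normrN => /(le_trans (ler_norm _)) epsj.
have [[_ _ [M KM]] rK] := bK j.
have [t Kt] := finite_rank_trace_cvg (bK j).1 KM rK.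
have H u v L : approx_identity u v L ->
    \forall n \near \oo, normc (approx_trace u v L T n - t) <= e / 2.
  move=> uv; have := Kt _ _ _ uv.
  move/cvgrPdist_le => /(_ _ e4); apply: filterS => n /=.
  rewrite sub0r normrN ger0_norm ?normc_ge0// => Ktn.
  have [ou ov _] := uv.
  have Lu i : L2 (u n i) by case: (ou n).
  have Lv i : L2 (v n i) by case: (ov n).
  have -> : approx_trace u v L T n - t =
      \sum_(0 <= i < L n) L2dot (op_sub T (K j) (u n i)) (v n i) +
      (approx_trace u v L (K j) n - t).
    rewrite addrA -big_split/=; congr (_ - _); apply: eq_bigr => i _.
    by rewrite L2dotBl ?subrK//; auto.
  have -> : e / 2 = e / 4 + e / 4 by field.
  rewrite (le_trans (le_normcD _ _))// lerD//.
  by rewrite (le_trans _ epsj)//; apply: TK => //; exact: iota_uniq.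
near=> n; rewrite sub0r normrN ger0_norm ?normc_ge0//.
have -> : approx_trace a b N T n - approx_trace a' b' N' T n =
  (approx_trace a b N T n - t) - (approx_trace a' b' N' T n - t) by ring.
rewrite (le_trans (le_normcD _ _))// normcN [leRHS]splitr lerD//.
  by near: n; exact: H.
by near: n; exact: H.
Unshelve. all: by end_near. Qed.

End TraceClass.

(** * Completeness and orthonormal bases *)

Section Completeness.
Context {R : realType}.
Local Notation C := R[i].
Local Notation mu := (@lebesgue_measure R).
Local Notation normc := complex.ComplexField.Normc.normc.
Implicit Types (f g h : R -> C) (z w : C).

Lemma cvg_halfX (c : R) : (fun k => c * 2^-1 ^+ k) @ \oo --> (0 : R).
Proof.
rewrite -[X in _ --> X](mulr0 c); apply: cvgM; first exact: cvg_cst.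
by apply: cvg_expr; rewrite ger0_norm; lra.
Qed.

(** Adding and subtracting the geometric tail [2 * c * 2^-1 ^+ k] turns the
    sequence into a nonincreasing and a nondecreasing one; their common limit
    lies between them, which gives the rate as well. *)
Lemma geometric_steps_cvg (r : nat -> R) (c : R) : 0 <= c ->
  (forall k, `|r k.+1 - r k| <= c * 2^-1 ^+ k) ->
  r @ \oo --> limn r /\ forall k, `|limn r - r k| <= 2 * c * 2^-1 ^+ k.
Proof.
move=> c0 rc; pose t k : R := 2 * c * 2^-1 ^+ k.
have step k : t k.+1 + c * 2^-1 ^+ k = t k.
  by rewrite /t exprS; set x := 2^-1 ^+ k; field.
have t0 k : 0 <= t k by rewrite /t mulr_ge0 ?mulr_ge0// exprn_ge0.
have up : nondecreasing_seq (fun k => r k - t k).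
  apply/nondecreasing_seqP => k; have := step k; have := rc k.
  by rewrite ler_norml => /andP[]; lra.
have dn : nonincreasing_seq (fun k => r k + t k).
  apply/nonincreasing_seqP => k; have := step k; have := rc k.
  by rewrite ler_norml => /andP[]; lra.
have tcvg : t @ \oo --> (0 : R) by exact: cvg_halfX.
have cup : cvgn (fun k => r k - t k).
  apply: nondecreasing_is_cvgn => //; exists (r 0%N + t 0%N) => _ [k _ <-].
  by have := dn _ _ (leq0n k); have := t0 k; lra.
have rcvg : r @ \oo --> limn (fun k => r k - t k).
  have : (fun k => (r k - t k) + t k) @ \oo --> limn (fun k => r k - t k) + 0.
    exact: cvgD.
  by rewrite addr0; under eq_fun do rewrite subrK.
have -> : limn r = limn (fun k => r k - t k) by exact/cvg_lim.
split => // k; rewrite ler_distl; apply/andP; split.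
  exact: nondecreasing_cvgn_le.
have cdn : (fun k => r k + t k) @ \oo --> limn (fun k => r k - t k).
  by rewrite -[X in _ --> X]addr0; exact: cvgD.
rewrite -(cvg_lim _ cdn)//; apply: nonincreasing_cvgn_ge => //.
by apply/cvg_ex; eexists; exact: cdn.
Qed.

Definition restr (A : set R) f : R -> C := fun x => (\1_A x)%:C%C * f x.

Lemma normc_restr (A : set R) f x : normc (restr A f x) = \1_A x * normc (f x).
Proof.
by rewrite complex.ComplexField.Normc.normcM normcr ger0_norm// indicE ler0n.
Qed.

Lemma cmeasurable_indic (A : set (measurableTypeR R)) : measurable A ->
  cmeasurable (fun x => (\1_A x)%:C%C).
Proof.
move=> mA; split => /=; last exact: measurable_cst.
exact: measurable_indic.
Qed.

Lemma L2_restr (A : set (measurableTypeR R)) f : measurable A -> L2 f ->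
  L2 (restr A f).
Proof.
move=> mA Lf; apply: (@le_L2 _ _ (fun x => normc (f x) ^+ 2)).
- by apply: cmeasurable_mul; [exact: cmeasurable_indic|case: Lf].
- exact: L2_integrable.
- by move=> x _; rewrite normc_restr exprMn ler_piMl ?sqr_ge0.
Qed.

Lemma sqr_L2norm_le f (b : R -> R) : L2 f -> mu.-integrable Rplus (EFin \o b) ->
  (forall x, Rplus x -> normc (f x) ^+ 2 <= b x) ->
  L2norm f ^+ 2 <= \int[mu]_(x in Rplus) b x.
Proof.
move=> Lf ib fb; rewrite sqr_L2norm; apply: le_Rintegral => //.
  exact: mRplus.
exact: L2_integrable.
Qed.

Lemma sqr_halfX k : (2^-1 ^+ k : R) ^+ 2 = 4^-1 ^+ k.
Proof.
by rewrite -exprM mulnC exprM; congr (_ ^+ _); rewrite expr2; field.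
Qed.

Section fast_Cauchy.
Variable v : nat -> R -> C.
Hypothesis Lv : forall k, L2 (v k).
Hypothesis vc : forall k,
  L2norm (fun x => v k.+1 x - v k x) ^+ 2 <= (4^-1 ^+ k) ^+ 2.

Let dv k x : R := 4 ^+ k * normc (v k.+1 x - v k x) ^+ 2.
Let W x : \bar R := (\sum_(0 <= k <oo) (dv k x)%:E)%E.

Let dv_ge0 k x : 0 <= dv k x.
Proof. by rewrite mulr_ge0 ?sqr_ge0// exprn_ge0. Qed.

Let mdv k : measurable_fun Rplus (fun x => (dv k x)%:E).
Proof.
apply/measurable_EFinP; apply: measurable_funM => //.
by apply: cmeasurable_sqnorm; case: (L2_sub (Lv k.+1) (Lv k)).
Qed.

Let W_ge0 x : (0 <= W x)%E.
Proof. by apply: nneseries_ge0 => k _ _; rewrite lee_fin. Qed.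

Let mW : measurable_fun Rplus W.
Proof.
by apply: ge0_emeasurable_sum => [k x _ _|k _] //; rewrite lee_fin.
Qed.

(** The weights leave room: the squared steps still sum to a function [W] that is
    integrable, hence finite almost everywhere, and where [W] is finite the steps
    decrease geometrically. *)
Let iW : mu.-integrable Rplus W.
Proof.
apply/integrableP; split => //.
under eq_integral do rewrite gee0_abs//.
rewrite integral_nneseries//; [|exact: mRplus|by move=> *; rewrite lee_fin].
apply: (@le_lt_trans _ _ (2%:E)); last exact: ltry.
apply: lime_le.
  apply: is_cvg_nneseries => n _ _; apply: integral_ge0 => x _.
  by rewrite lee_fin.
apply: nearW => n.
apply: (@le_trans _ _ (\sum_(0 <= k < n) (4^-1 ^+ k)%:E)%E).
  apply: lee_sum => k _; under eq_integral do rewrite EFinM.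
  have Ld := L2_sub (Lv k.+1) (Lv k).
  rewrite integralZl//; [|exact: mRplus|exact: L2_integrable].
  rewrite -sqr_L2normE// -EFinM lee_fin.
  rewrite (@le_trans _ _ (4 ^+ k * (4^-1 ^+ k) ^+ 2))//.
    by rewrite ler_wpM2l// exprn_ge0.
  by rewrite expr2 mulrA -exprMn mulfV// expr1n mul1r.
rewrite sumEFin lee_fin.
have := @geometric_le_lim R n 1 4^-1 ler01; rewrite /series/= /geometric/=.
under eq_bigr do rewrite mul1r.
move=> H; have : \sum_(0 <= i < n) (4^-1 : R) ^+ i <= 1 / (1 - 4^-1).
  by apply: H; [|rewrite ger0_norm]; lra.
by move/le_trans; apply; rewrite ler_pdivrMr; lra.
Qed.

Let E : set (measurableTypeR R) := Rplus `&` [set x | W x < +oo]%E.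

Let mE : measurable E.
Proof. exact: (emeasurable_fun_infty_o mRplus mW). Qed.

Let step x k : E x ->
  normc (v k.+1 x - v k x) <= Num.sqrt (fine (W x)) * 2^-1 ^+ k.
Proof.
move=> [px Wx]; have Wf : W x \is a fin_num by rewrite ge0_fin_numE.
rewrite -(@ler_pXn2r _ 2)// ?nnegrE ?normc_ge0 ?mulr_ge0 ?sqrtr_ge0 ?exprn_ge0//.
rewrite exprMn sqr_sqrtr ?fine_ge0// sqr_halfX.
have : dv k x <= fine (W x).
  rewrite -lee_fin fineK//; apply: le_trans (nneseries_lim_ge k.+1 _).
    rewrite big_nat_recr//= leeDr// sume_ge0// => i _.
    by rewrite lee_fin.
  by move=> n _ _; rewrite lee_fin.
have e4 : 4^-1 ^+ k * 4 ^+ k = 1 :> R by rewrite -exprMn mulVf// expr1n.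
have : 0 <= 4^-1 ^+ k :> R by rewrite exprn_ge0.
move=> p4 /(ler_wpM2l p4); rewrite /dv mulrA e4 mul1r.
by rewrite [_ * fine _]mulrC.
Qed.

Let g x : C := Complex (limn (fun k => complex.Re (restr E (v k) x)))
                       (limn (fun k => complex.Im (restr E (v k) x))).

Let restrE x f : E x -> restr E f x = f x.
Proof. by move=> Ex; rewrite /restr indicE mem_set// mul1r. Qed.

Let restrNE x f : ~ E x -> restr E f x = 0.
Proof. by move=> Ex; rewrite /restr indicE memNset// mul0r. Qed.

Let W' x := Num.sqrt (fine (W x)).

Let ReIm_cvg x : Rplus x ->
  [/\ (fun k => complex.Re (restr E (v k) x)) @ \oo --> complex.Re (g x),
      (fun k => complex.Im (restr E (v k) x)) @ \oo --> complex.Im (g x) &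
      forall k, normc (restr E (v k) x - g x) ^+ 2 <=
        8 * 4^-1 ^+ k * fine (W x)].
Proof.
move=> px.
have st k : normc (restr E (v k.+1) x - restr E (v k) x) <= W' x * 2^-1 ^+ k.
  have [Ex|Ex] := pselect (E x); first by rewrite !restrE// step.
  rewrite !restrNE// subrr complex.ComplexField.Normc.normc0.
  by rewrite mulr_ge0 ?sqrtr_ge0// exprn_ge0.
have W0 : 0 <= W' x by exact: sqrtr_ge0.
have [r1 r2] : (fun k => complex.Re (restr E (v k) x)) @ \oo --> complex.Re (g x)
   /\ forall k, `|complex.Re (g x) - complex.Re (restr E (v k) x)| <=
       2 * W' x * 2^-1 ^+ k.
  apply: geometric_steps_cvg => // k; rewrite -Re_sub.
  exact: le_trans (normc_Re _) (st k).
have [i1 i2] : (fun k => complex.Im (restr E (v k) x)) @ \oo --> complex.Im (g x)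
   /\ forall k, `|complex.Im (g x) - complex.Im (restr E (v k) x)| <=
       2 * W' x * 2^-1 ^+ k.
  apply: geometric_steps_cvg => // k; rewrite -Im_sub.
  exact: le_trans (normc_Im _) (st k).
split => // k; rewrite sqr_normcE Re_sub Im_sub.
have sq u : `|u| <= 2 * W' x * 2^-1 ^+ k ->
    u ^+ 2 <= 4 * 4^-1 ^+ k * fine (W x).
  move=> ub; rewrite -real_normK ?num_real//.
  apply: (@le_trans _ _ ((2 * W' x * 2^-1 ^+ k) ^+ 2)).
    by rewrite ler_pXn2r// nnegrE ?mulr_ge0// exprn_ge0.
  by rewrite !exprMn sqr_halfX sqr_sqrtr ?fine_ge0//; lra.
have := sq _ (r2 k); have := sq _ (i2 k).
rewrite -[(_ - complex.Re (restr _ _ _)) ^+ 2]sqrrN.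
rewrite -[(_ - complex.Im (restr _ _ _)) ^+ 2]sqrrN !opprB.
by lra.
Qed.

Let ifW : mu.-integrable Rplus (EFin \o (fun x => fine (W x))).
Proof.
apply: le_integrable iW; first exact: mRplus.
  by apply/measurable_EFinP; apply: (measurableT_comp _ mW); exact: fine_measurable.
move=> x px /=; rewrite gee0_abs// ger0_norm ?fine_ge0//.
by case: (W x) (W_ge0 x) => [r||]//=; rewrite leey.
Qed.

(** Outside the null set where [W] is infinite the sequence converges pointwise,
    and there [W] also controls the error, so the convergence is in norm. *)
Lemma fast_Cauchy_cvg : exists2 g, L2 g &
  (fun k => L2norm (fun x => v k x - g x)) @ \oo --> (0 : R).
Proof.
have Lr k : L2 (restr E (v k)) by exact: L2_restr.
have mg : cmeasurable g.
  split.
    apply: (@measurable_fun_cvg _ _ _ _ (fun k x => complex.Re (restr E (v k) x))).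
      by move=> k; case: (Lr k) => -[].
    by move=> x /ReIm_cvg[].
  apply: (@measurable_fun_cvg _ _ _ _ (fun k x => complex.Im (restr E (v k) x))).
    by move=> k; case: (Lr k) => -[].
  by move=> x /ReIm_cvg[].
have ib k : mu.-integrable Rplus (EFin \o (fun x => 8 * 4^-1 ^+ k * fine (W x))).
  have := integrableZl mRplus (8 * 4^-1 ^+ k) ifW.
  by apply: eq_integrable => [|x _]; [exact: mRplus|].
have Ld k : L2 (fun x => restr E (v k) x - g x).
  apply: le_L2 (ib k) _; last by move=> x /ReIm_cvg[].
  have := @cmeasurable_lin R (-1) g (restr E (v k)) mg (L2_cmeasurable (Lr k)).
  by under eq_fun do rewrite mulN1r addrC.
have Lg : L2 g.
  have := L2_sub (Lr 0%N) (Ld 0%N).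
  by under eq_fun do rewrite opprB addrC subrK.
exists g => //.
have vr k : eqL2 (v k) (restr E (v k)).
  have := integrable_ae mRplus iW; apply: filterS => x Wx px.
  rewrite restrE//; split => //=; move: (Wx px).
  by rewrite ge0_fin_numE.
have vrg k : eqL2 (fun x => v k x - g x) (fun x => restr E (v k) x - g x).
  by have := vr k; apply: filterS => x /[apply] ->.
pose M := Num.sqrt (8 * \int[mu]_(x in Rplus) fine (W x)).
have W1 : 0 <= \int[mu]_(x in Rplus) fine (W x).
  by apply: Rintegral_ge0 => x _; rewrite fine_ge0.
have bound k : L2norm (fun x => v k x - g x) <= M * 2^-1 ^+ k.
  rewrite (eq_L2norm (L2_sub (Lv k) Lg) (Ld k) (vrg k)).
  rewrite -(@ler_pXn2r _ 2)// ?nnegrE ?L2norm_ge0 ?mulr_ge0 ?sqrtr_ge0 ?exprn_ge0//.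
  rewrite exprMn sqr_halfX [M ^+ 2]sqr_sqrtr ?mulr_ge0//.
  rewrite (le_trans (sqr_L2norm_le (Ld k) (ib k) _))//.
    by move=> x /ReIm_cvg[].
  by rewrite RintegralZl//; [rewrite mulrAC|exact: mRplus].
apply: (@squeeze_cvgr _ _ _ _ (fun=> 0) (fun k => M * 2^-1 ^+ k)).
- by apply: nearW => k; rewrite L2norm_ge0 bound.
- exact: cvg_cst.
- exact: cvg_halfX.
Qed.

End fast_Cauchy.

Lemma L2norm_subC f g : L2 f -> L2 g ->
  L2norm (fun x => f x - g x) = L2norm (fun x => g x - f x).
Proof.
move=> Lf Lg; rewrite -(L2normN (L2_sub Lf Lg)).
by under eq_fun do rewrite opprB.
Qed.

(** The Riesz-Fischer theorem. A Cauchy sequence has a subsequence to which the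
    previous lemma applies, and it converges wherever a subsequence does. *)
Theorem L2_complete (u : nat -> R -> C) : (forall n, L2 (u n)) ->
  (forall e, 0 < e -> exists N, forall n m, (N <= n)%N -> (N <= m)%N ->
    L2norm (fun x => u n x - u m x) <= e) ->
  exists2 g, L2 g & (fun n => L2norm (fun x => u n x - g x)) @ \oo --> (0 : R).
Proof.
move=> Lu uc.
have HN k : {N | forall n m, (N <= n)%N -> (N <= m)%N ->
    L2norm (fun x => u n x - u m x) <= 4^-1 ^+ k}.
  by apply: cid; apply: uc; rewrite exprn_gt0.
pose n k := (\sum_(0 <= i < k.+1) sval (HN i))%N.
have nN k : (sval (HN k) <= n k)%N by rewrite /n big_nat_recr//= leq_addl.
have nS k : (n k <= n k.+1)%N by rewrite /n [leqRHS]big_nat_recr//= leq_addr.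
have [g Lg vg] : exists2 g, L2 g &
    (fun k => L2norm (fun x => u (n k) x - g x)) @ \oo --> (0 : R).
  apply: (@fast_Cauchy_cvg (fun k => u (n k))) => [//|k].
  rewrite ler_pXn2r ?nnegrE ?L2norm_ge0 ?exprn_ge0//.
  by apply: (svalP (HN k)) => //; exact: leq_trans (nS k).
exists g => //; apply/cvgrPdist_le => e e0.
have e2 : 0 < e / 2 by rewrite divr_gt0.
have [N uN] := uc _ e2.
move/cvgrPdist_le : vg => /(_ _ e2) [k0 _ vk].
have qcvg : (fun k => 4^-1 ^+ k : R) @ \oo --> (0 : R).
  by apply: cvg_expr; rewrite ger0_norm; lra.
move/cvgrPdist_le : qcvg => /(_ _ e2) [k1 _ qk].
pose k := maxn k0 k1.
exists (n k) => // m nm /=.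
rewrite sub0r normrN ger0_norm ?L2norm_ge0//.
rewrite (le_trans (L2norm_sub_trans (Lu m) (Lu (n k)) Lg))// [leRHS]splitr lerD//.
  apply: (@le_trans _ _ (4^-1 ^+ k)).
    by apply: (svalP (HN k)) => //; exact: leq_trans nm.
  have := qk k (leq_maxr _ _); rewrite sub0r normrN.
  by rewrite ger0_norm ?exprn_ge0.
have := vk k (leq_maxl _ _); rewrite sub0r normrN ger0_norm//.
exact: L2norm_ge0.
Qed.

Lemma orthonormal_basis_orthocontractive (e : nat -> R -> C) :
  orthonormal_basis e -> orthocontractive e.
Proof.
move=> [Le eo _]; split => // [i j ij|i]; first by rewrite eo (negbTE ij).
rewrite -(@ler_pXn2r _ 2)// ?nnegrE ?L2norm_ge0// expr1n.
by have := L2dotff (e i); rewrite eo eqxx => -[<-].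
Qed.

(** Parseval: the Fourier partial sums converge by completeness, and the
    difference between a vector and their limit is orthogonal to the basis. *)
Theorem orthonormal_basis_approx_identity (e : nat -> R -> C) :
  orthonormal_basis e -> approx_identity (fun=> e) (fun=> e) id.
Proof.
move=> be; have oe := orthonormal_basis_orthocontractive be.
have [Le eo etot] := be; split => // f Lf.
pose c i := L2dot f (e i).
pose P n x := \sum_(0 <= i < n) c i * e i x.
have LP n : L2 (P n) by exact: L2_comb.
have cS : cvgn (series (fun i => normc (c i) ^+ 2)).
  apply: nondecreasing_is_cvgn.
    by apply: nondecreasing_series => i _ _; rewrite sqr_ge0.
  exists (L2norm f ^+ 2) => _ [n _ <-].
  exact: (Bessel oe (iota_uniq _ _) Lf).
have Pc n m : (m <= n)%N -> L2norm (fun x => P n x - P m x) ^+ 2 <=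
    series (fun i => normc (c i) ^+ 2) n - series (fun i => normc (c i) ^+ 2) m.
  move=> mn; rewrite sub_series_geq//.
  rewrite (le_trans _ (sqr_L2norm_comb_le oe (iota_uniq _ _) c))//.
  rewrite le_eqVlt; apply/orP; left; apply/eqP; congr (L2norm _ ^+ 2).
  apply/funext => x; rewrite /P (big_cat_nat (leq0n _) mn)/=.
  by rewrite addrAC subrr add0r.
have [g Lg Pg] : exists2 g, L2 g &
    (fun n => L2norm (fun x => P n x - g x)) @ \oo --> (0 : R).
  apply: L2_complete => // d d0.
  have d2 : 0 < d ^+ 2 by rewrite exprn_gt0.
  pose S := series (fun i => normc (c i) ^+ 2).
  have /cvgrPdist_le/(_ _ d2)[N _ SN] := cS.
  have Sd : nondecreasing_seq S by apply: nondecreasing_series => i _ _; rewrite sqr_ge0.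
  exists N => n m Nn Nm; wlog mn : n m Nn Nm / (m <= n)%N => [H|].
    have [mn|/ltnW nm] := leqP m n; first exact: H.
    by rewrite L2norm_subC// H.
  rewrite -(@ler_pXn2r _ 2)// ?nnegrE ?L2norm_ge0 ?(ltW d0)//.
  rewrite (le_trans (Pc _ _ mn))//.
  have := SN N (leqnn N); move=> /(le_trans (ler_norm _)).
  have := Sd _ _ Nm; have := nondecreasing_cvgn_le Sd cS n.
  by rewrite /S; lra.
have fg : eqL2 f g.
  have Lfg := L2_sub Lf Lg.
  suff /etot H : forall i, L2dot (fun x => f x - g x) (e i) = 0.
    by have := H Lfg; apply: filterS => x /[apply] /eqP; rewrite subr_eq0 => /eqP.
  move=> i; apply: complex.ComplexField.Normc.eq0_normc.
  apply/eqP; rewrite eq_le normc_ge0 andbT; apply/ler_addgt0Pr => d d0.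
  move/cvgrPdist_le : Pg => /(_ _ d0) [N _ PN].
  pose n := maxn N i.+1; have := PN n (leq_maxl _ _).
  rewrite sub0r normrN ger0_norm ?L2norm_ge0// add0r; apply: le_trans.
  have -> : L2dot (fun x => f x - g x) (e i) = L2dot (fun x => P n x - g x) (e i).
    rewrite !L2dotBl//; congr (_ - _).
    rewrite L2dot_combl// (orthocontractive_dot oe (iota_uniq _ _)).
      by rewrite -L2dotff eo eqxx mulr1.
    by rewrite mem_index_iota/= /n leq_max leqnn orbT.
  rewrite (le_trans (Cauchy_Schwarz (L2_sub (LP n) Lg) (Le i)))//.
  by have [_ _ e1] := oe; rewrite ler_piMr ?L2norm_ge0.
move: Pg; apply: cvg_trans; apply: near_eq_cvg; apply: nearW => n.
rewrite (L2norm_subC Lf (LP n)).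
apply: (eq_L2norm (L2_sub (LP n) Lg) (L2_sub (LP n) Lf)).
by have := fg; apply: filterS => x /[apply] ->.
Qed.

End Completeness.

(** * Indicator functions *)

Section Indicators.
Context {R : realType}.
Local Notation C := R[i].
Local Notation mu := (@lebesgue_measure R).
Local Notation normc := complex.ComplexField.Normc.normc.
Implicit Types (f g h : R -> C) (z w : C).

Lemma L2norm_dominated_cvg0 (u : nat -> R -> C) (b : R -> R) :
  (forall n, L2 (u n)) -> mu.-integrable Rplus (EFin \o b) ->
  (forall n x, Rplus x -> normc (u n x) ^+ 2 <= b x) ->
  {ae mu, forall x, Rplus x -> (fun n => normc (u n x) ^+ 2) @ \oo --> (0 : R)} ->
  (fun n => L2norm (u n)) @ \oo --> (0 : R).
Proof.
move=> Lu ib ub u0.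
have [|||||_ _ H] := @dominated_convergence _ _ _ mu Rplus mRplus
  (fun n x => (normc (u n x) ^+ 2)%:E) (cst 0%E) (EFin \o b) => //.
- by move=> n; apply/measurable_EFinP; apply: cmeasurable_sqnorm; case: (Lu n).
- move: u0; apply: (@filterS _ _ (ae_filter_ringOfSetsType mu)) => x /[apply] ux.
  by apply: cvg_EFin => //; exact: nearW.
- apply: aeW => x n px /=; rewrite lee_fin ger0_norm ?sqr_ge0//; exact: ub.
have E n : (\int[mu]_(x in Rplus) (normc (u n x) ^+ 2)%:E)%E =
    (L2norm (u n) ^+ 2)%:E by rewrite sqr_L2normE.
move: H; rewrite integral_cst ?mul0e//; last exact: mRplus.
under eq_fun do rewrite E.
move/fine_cvgP => [_ H].
have : (fun n => Num.sqrt (L2norm (u n) ^+ 2)) @ \oo --> Num.sqrt (0 : R).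
  apply: continuous_cvg; first exact: sqrt_continuous.
  exact: H.
rewrite sqrtr0; under eq_fun do rewrite sqrtr_sqr ger0_norm ?L2norm_ge0//.
exact.
Qed.

Definition cintegral_on (A : set R) f : C :=
  Complex (\int[mu]_(x in A) complex.Re (f x))
          (\int[mu]_(x in A) complex.Im (f x)).

Definition rindic (c : R) (A : set R) : R -> C := fun x => (c * \1_A x)%:C%C.

Section indicator.
Variables (A : set (measurableTypeR R)).
Hypotheses (mA : measurable A) (AR : A `<=` Rplus) (Afin : (mu A < +oo)%E).

Lemma integrable_cst_on (c : R) : mu.-integrable A (EFin \o cst c).
Proof.
apply/integrableP; split; first by apply/measurable_EFinP; exact: measurable_cst.
by rewrite /= integral_cst//= lte_mul_pinfty.
Qed.

Lemma integrable_indic_on : mu.-integrable Rplus (EFin \o \1_A).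
Proof.
have -> : EFin \o \1_A = (EFin \o cst 1) \_ A :> (R -> \bar R).
  by apply/funext => x; rewrite patchE /= indicE; case: (_ \in _).
apply/(integrable_restrict mu mA mRplus).
by rewrite setIidr//; exact: integrable_cst_on.
Qed.

Lemma integrable_on_of_L2 f : L2 f ->
  mu.-integrable A (EFin \o (fun x => complex.Re (f x))) /\
  mu.-integrable A (EFin \o (fun x => complex.Im (f x))).
Proof.
move=> Lf; have [mr mi] := L2_cmeasurable Lf.
have ib : mu.-integrable A (EFin \o (fun x => 1 + normc (f x) ^+ 2)).
  have := integrableD mA (integrable_cst_on 1)
    (integrableS mRplus mA AR (L2_integrable Lf)).
  by apply: eq_integrable.
have le1 (u : R) z : `|u| <= normc z -> `|u| <= `|1 + normc z ^+ 2|.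
  move=> uz; rewrite [leRHS]ger0_norm ?addr_ge0 ?sqr_ge0//.
  apply: (le_trans uz); have := normc_ge0 z; set n := normc z.
  by have := sqr_ge0 (n - 1); nra.
split; apply: (le_integrable mA _ _ ib).
- by apply/measurable_EFinP; exact: (measurable_funS mRplus AR mr).
- by move=> x _ /=; rewrite lee_fin; exact: le1 (normc_Re _).
- by apply/measurable_EFinP; exact: (measurable_funS mRplus AR mi).
- by move=> x _ /=; rewrite lee_fin; exact: le1 (normc_Im _).
Qed.

Lemma Rintegral_indic (u : R -> R) c : mu.-integrable A (EFin \o u) ->
  \int[mu]_(x in Rplus) (c * (u x * \1_A x)) = c * \int[mu]_(x in A) u x.
Proof.
move=> iu; have uE x : u x * \1_A x = (u \_ A) x.
  rewrite patchE indicE; case: (x \in A); first by rewrite mulr1.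
  by rewrite mulr0.
under eq_Rintegral do rewrite uE.
rewrite RintegralZl; [|exact: mRplus|].
  by rewrite -Rintegral_mkcondr setIidr.
by rewrite -restrict_EFin; apply/(integrable_restrict mu mA mRplus);
  rewrite setIidr.
Qed.

Lemma L2dot_rindic f c : L2 f ->
  L2dot f (rindic c A) = c%:C%C * cintegral_on A f.
Proof.
move=> /integrable_on_of_L2[ir ii]; rewrite /L2dot /cintegral /cintegral_on.
apply: complex_ext; rewrite ?Re_mul ?Im_mul /= mul0r ?subr0 ?addr0 -Rintegral_indic//.
  by apply: eq_Rintegral => x _; rewrite Re_mul Re_conjc Im_conjc /=; ring.
by apply: eq_Rintegral => x _; rewrite Im_mul Re_conjc Im_conjc /=; ring.
Qed.

Lemma L2_rindic c : L2 (rindic c A).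
Proof.
apply: (@le_L2 _ _ (fun x => c ^+ 2 * \1_A x)).
- have := @cmeasurable_mul R (fun=> c%:C%C) _ _ (cmeasurable_indic mA).
  rewrite /rindic; under [fun x => (_ * _)%:C%C]eq_fun do rewrite rmorphM.
  by apply; split; exact: measurable_cst.
- have := integrableZl mRplus (c ^+ 2) integrable_indic_on.
  by apply: eq_integrable => [|x _]; [exact: mRplus|].
- move=> x _; rewrite normcr real_normK ?num_real// exprMn ler_wpM2l ?sqr_ge0//.
  by rewrite indicE; case: (_ \in _); rewrite ?expr1n ?expr0n.
Qed.

Lemma sqr_L2norm_rindic c : L2norm (rindic c A) ^+ 2 = c ^+ 2 * fine (mu A).
Proof.
have := L2dotff (rindic c A); rewrite L2dot_rindic; last exact: L2_rindic.
move/(congr1 (@complex.Re R)); rewrite Re_mul /= mul0r subr0 => <-.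
rewrite [X in _ * X](_ : _ = c * fine (mu A)); first by ring.
rewrite -Rintegral_cst//; apply: eq_Rintegral => x xA.
by rewrite /= indicE xA mulr1.
Qed.

End indicator.

Lemma L2dot_rindic_disj c d (A B : set R) : A `&` B = set0 ->
  L2dot (rindic c A) (rindic d B) = 0.
Proof.
move=> AB; rewrite -(L2dot0l (rindic d B)) /L2dot; congr cintegral.
apply/funext => x; rewrite mul0r /rindic !indicE.
have [xA|_] := boolP (x \in A); last by rewrite mulr0 rmorph0 mul0r.
have [xB|_] := boolP (x \in B); last by rewrite mulr0 !rmorph0 mulr0.
have : (A `&` B) x by split; exact/set_mem.
by rewrite AB.
Qed.

End Indicators.

(** * Averages over shifted cells *)

Section Cells.
Context {R : realType}.
Local Notation C := R[i].
Local Notation mu := (@lebesgue_measure R).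
Local Notation normc := complex.ComplexField.Normc.normc.
Implicit Types (f g h : R -> C) (z w : C).

(** The length is a power of [4] so that normalizing the indicator function takes
    the factor [2 ^+ n]. *)
Definition cell (n k : nat) : set R :=
  `[k%:R * 4^-1 ^+ n, k.+1%:R * 4^-1 ^+ n[.

Lemma cellP n k x : cell n k x <-> k%:R <= x * 4 ^+ n < k.+1%:R.
Proof.
by rewrite /cell /= in_itv/= exprVn ler_pdivrMr ?ltr_pdivlMr ?exprn_gt0.
Qed.

Lemma measurable_cell n k : measurable (cell n k : set (measurableTypeR R)).
Proof. exact: measurable_itv. Qed.

Lemma mu_cell n k : mu (cell n k) = (4^-1 ^+ n)%:E.
Proof.
have q0 : 0 < 4^-1 ^+ n :> R by rewrite exprn_gt0.
rewrite /cell lebesgue_measure_itv/= lte_fin ltr_pM2r// ltr_nat ltnSn.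
by rewrite -EFinD -mulrBl -natrB// subSnn mul1r.
Qed.

Lemma mu_cell_fin n k : (mu (cell n k) < +oo)%E.
Proof. by rewrite mu_cell ltry. Qed.

Lemma cell_Rplus n k : (0 < k)%N -> cell n k `<=` Rplus.
Proof.
move=> k0 x /cellP/andP[kx _]; rewrite /Rplus /= in_itv/= andbT.
have : 0 < x * 4 ^+ n by apply: lt_le_trans kx; rewrite ltr0n.
by rewrite pmulr_lgt0// exprn_gt0.
Qed.

Lemma cell_truncn n x : 0 <= x -> cell n (Num.truncn (x * 4 ^+ n)) x.
Proof. by move=> x0; apply/cellP/truncn_itv; rewrite mulr_ge0// exprn_ge0. Qed.

Lemma cell_inj n i j x : cell n i x -> cell n j x -> i = j.
Proof.
by move=> /cellP/truncn_def ix /cellP/truncn_def jx; rewrite -ix -jx.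
Qed.

Lemma cell_orthocontractive n m : (0 < m)%N ->
  orthocontractive (fun i => rindic (2 ^+ n) (cell n (i + m))).
Proof.
move=> m0; have im i : (0 < i + m)%N by rewrite addn_gt0 m0 orbT.
split=> [i|i j ij|i].
- apply: L2_rindic; [exact: measurable_cell|exact: cell_Rplus|exact: mu_cell_fin].
- apply: L2dot_rindic_disj; apply/seteqP; split => // x [xi xj].
  by move: (cell_inj xi xj) => /addIn/eqP; rewrite (negbTE ij).
- rewrite -(@ler_pXn2r _ 2)// ?nnegrE ?L2norm_ge0// sqr_L2norm_rindic.
  + rewrite mu_cell/= -exprM mulnC exprM -exprMn expr1n.
    by rewrite (_ : 2 ^+ 2 / 4 = 1) ?expr1n//; field.
  + exact: measurable_cell.
  + exact: cell_Rplus.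
  + exact: mu_cell_fin.
Qed.

Definition shift_out n i := rindic (2 ^+ n) (cell n (i + 1)).
Definition shift_in n i := rindic (2 ^+ n) (cell n (i + 2)).
(** Enough cells of length [4^-1 ^+ n] to reach [4 ^+ n]. *)
Definition shift_size (n : nat) := (16 ^ n)%N.

(** On each cell the value is the average of [f] over the next one. Shifting
    costs nothing for convergence, and it is what later makes the trace sums
    avoid the diagonal of the kernel. *)
Definition shift_avg n f : R -> C := fun x =>
  \sum_(0 <= i < shift_size n) L2dot f (shift_in n i) * shift_out n i x.

Lemma L2_shift_out n i : L2 (shift_out n i).
Proof. by case: (@cell_orthocontractive n 1 isT) => L _ _; exact: L. Qed.

Lemma L2_shift_in n i : L2 (shift_in n i).
Proof. by case: (@cell_orthocontractive n 2 isT) => L _ _; exact: L. Qed.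

Lemma L2_shift_avg n f : L2 (shift_avg n f).
Proof. by apply: L2_comb => i; exact: L2_shift_out. Qed.

Lemma L2dot_shift_in n i f : L2 f ->
  L2dot f (shift_in n i) = (2 ^+ n)%:C%C * cintegral_on (cell n (i + 2)) f.
Proof.
move=> Lf; rewrite L2dot_rindic//; [exact: measurable_cell| |exact: mu_cell_fin].
by apply: cell_Rplus; rewrite addn2.
Qed.

Lemma shift_avgE n f x k : L2 f -> cell n k.+1 x -> (k < shift_size n)%N ->
  shift_avg n f x = (4 ^+ n)%:C%C * cintegral_on (cell n k.+2) f.
Proof.
move=> Lf kx kN; rewrite /shift_avg (bigD1_seq k)/= ?iota_uniq ?mem_index_iota//.
rewrite big1 ?addr0 => [|i ik]; last first.
  rewrite /shift_out /rindic indicE memNset ?mulr0//.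
  by rewrite addn1 => /(cell_inj kx)[]/eqP; rewrite eq_sym (negbTE ik).
rewrite L2dot_shift_in// addn2 /shift_out /rindic addn1 indicE mem_set// mulr1.
rewrite mulrAC -rmorphM/= -exprMn.
by rewrite (_ : 2 * 2 = 4)//; ring.
Qed.

Lemma shift_avg0 n f x : (forall k, (k < shift_size n)%N -> ~ cell n k.+1 x) ->
  shift_avg n f x = 0.
Proof.
move=> kx; rewrite /shift_avg big_nat big1// => i /andP[_ iN].
by rewrite /shift_out /rindic addn1 indicE memNset ?mulr0//; exact: kx.
Qed.

Lemma L2norm_shift_avg_le n f : L2 f -> L2norm (shift_avg n f) <= L2norm f.
Proof.
move=> Lf; rewrite -(@ler_pXn2r _ 2)// ?nnegrE ?L2norm_ge0//.
have oo := @cell_orthocontractive n 1 isT.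
have oi := @cell_orthocontractive n 2 isT.
rewrite (le_trans (sqr_L2norm_comb_le oo (iota_uniq _ _) _))//.
exact: (Bessel oi (iota_uniq _ _) Lf).
Qed.

(** The cell to the right of the one containing [x]. Negative points are only
    given a family of sets because the differentiation theorem asks for one
    at every point. *)
Definition next_cell (x : R) n : set R :=
  if 0 <= x then cell n (Num.truncn (x * 4 ^+ n)).+1 else ball x (2 * 4^-1 ^+ n).

Lemma nicely_shrinking_next_cell x : nicely_shrinking x (next_cell x).
Proof.
have q0 n : 0 < 2 * 4^-1 ^+ n :> R by rewrite mulr_gt0// exprn_gt0.
split=> [n|].
  rewrite /next_cell; case: ifP => _; first exact: measurable_cell.
  exact: measurable_ball.
exists (4, fun n => PosNum (q0 n)); split => //=.
- rewrite -[X in _ --> X](mulr0 2); apply: cvgM; first exact: cvg_cst.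
  by apply: cvg_expr; rewrite ger0_norm; lra.
- move=> n y; rewrite /next_cell; case: ifPn => // x0.
  have /cellP/andP[] := cell_truncn n x0; set k := Num.truncn _ => kx xk.
  move=> /cellP/andP[ky yk]; rewrite /ball/=.
  have p0 : 0 < 4 ^+ n :> R by rewrite exprn_gt0.
  rewrite exprVn ltr_pdivlMr// -{1}(gtr0_norm p0) -normrM mulrBl.
  rewrite ltr_norml; move: kx xk ky yk; rewrite -!natr1.
  by move=> *; apply/andP; split; lra.
- move=> n; rewrite lebesgue_measure_ball ?(ltW (q0 n))// /next_cell.
  case: ifPn => _; first by rewrite mu_cell -EFinM lee_fin -mulr_natl; lra.
  rewrite lebesgue_measure_ball ?(ltW (q0 n))// -EFinM lee_fin -mulr_natl.
  by have := q0 n; lra.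
Qed.

Lemma next_cellE x n : 0 < x -> 1 <= x * 4 ^+ n -> x < 4 ^+ n -> exists k,
  [/\ (k < shift_size n)%N, cell n k.+1 x & next_cell x n = cell n k.+2].
Proof.
move=> x0 x1 xn; have := cell_truncn n (ltW x0).
set t := Num.truncn (x * 4 ^+ n) => tx.
have t0 : (0 < t)%N by rewrite truncn_gt0.
exists t.-1; rewrite prednK//; split => //; last first.
  by rewrite /next_cell ltW// -/t prednK.
rewrite -(ler_nat R) natrX.
have /cellP/andP[+ _] := tx => /le_trans; apply.
rewrite (_ : 16 = 4 * 4) ?exprMn; last by ring.
by rewrite ler_wpM2r ?exprn_ge0// ltW.
Qed.

Lemma near_next_cell (x : R) : 0 < x ->
  \forall n \near \oo, 1 <= x * 4 ^+ n /\ x < 4 ^+ n.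
Proof.
move=> x0; near=> n.
have n4 : n%:R < 4 ^+ n :> R by rewrite -natrX ltr_nat ltn_expl.
split.
  rewrite mulrC -ler_pdivrMr// div1r (le_trans _ (ltW n4))//.
  by near: n; exact: nbhs_infty_ger.
apply: le_lt_trans n4.
by near: n; exact: nbhs_infty_ger.
Unshelve. all: by end_near. Qed.

Lemma sqr_dist_cvg0 (v : nat -> R) (l : R) : v @ \oo --> l ->
  (fun n => (v n - l) ^+ 2) @ \oo --> (0 : R).
Proof.
move=> vl; have d : (fun n => v n - l) @ \oo --> (0 : R).
  by rewrite -(subrr l); apply: cvgB => //; exact: cvg_cst.
have d2 : (fun n => (v n - l) * (v n - l)) @ \oo --> (0 * 0 : R).
  exact: cvgM.
by rewrite mulr0 in d2; under eq_cvg do rewrite expr2.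
Qed.

(** Lebesgue differentiation along the next cells: they do not contain the point,
    but have a fixed proportion of the ball around it that covers them. *)
Lemma shift_avg_cvg f : L2 f -> cL1 f ->
  {ae mu, forall x, Rplus x ->
    (fun n => normc (shift_avg n f x - f x) ^+ 2) @ \oo --> (0 : R)}.
Proof.
move=> Lf [iR iI].
have liR := integrable_locally_restrict mRplus iR.
have liI := integrable_locally_restrict mRplus iI.
have aeF := ae_filter_ringOfSetsType mu.
have := @filterI _ _ aeF _ _ (lebesgue_differentiation liR)
  (lebesgue_differentiation liI).
apply: (@filterS _ _ aeF) => x [xR xI] px.
have x0 : 0 < x by move: px; rewrite /Rplus /= in_itv/= andbT.
have avg (u : R -> R) : mu.-integrable Rplus (EFin \o u) ->
    lebesgue_pt (u \_ Rplus) x ->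
    (fun n => 4 ^+ n * \int[mu]_(y in next_cell x n) u y) @ \oo --> u x.
  move=> iu ux; have lu := integrable_locally_restrict mRplus iu.
  have := nice_lebesgue_differentiation nicely_shrinking_next_cell lu ux.
  rewrite [(u \_ Rplus) x]patchE mem_set// => /fine_cvgP[_].
  apply: cvg_trans; apply: near_eq_cvg.
  apply: filterS (near_next_cell x0) => n [x1 xn].
  have [k [kN kx nE]] := next_cellE x0 x1 xn.
  have mc := @measurable_cell n k.+2.
  have cR : cell n k.+2 `<=` Rplus by exact: cell_Rplus.
  have iuc : mu.-integrable (cell n k.+2) (EFin \o u).
    exact: (integrableS mRplus mc cR iu).
  rewrite /= nE mu_cell /Rintegral.
  have -> : (\int[mu]_(y in cell n k.+2) ((u \_ Rplus) y)%:E =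
             \int[mu]_(y in cell n k.+2) (u y)%:E)%E.
    apply: eq_integral => y /set_mem/cR py.
    by rewrite patchE mem_set.
  rewrite inver gt_eqF ?exprn_gt0// -exprVn invrK fineM//.
  exact: (integrable_fin_num mc iuc).
have rR := avg _ iR xR; have rI := avg _ iI xI.
have avgE (n : nat) : 1 <= x * 4 ^+ n -> x < 4 ^+ n -> shift_avg n f x =
    Complex (4 ^+ n * \int[mu]_(y in next_cell x n) complex.Re (f y))
            (4 ^+ n * \int[mu]_(y in next_cell x n) complex.Im (f y)).
  move=> x1 xn; have [k [kN kx ->]] := next_cellE x0 x1 xn.
  rewrite (shift_avgE Lf kx kN) /cintegral_on; apply: complex_ext.
    by rewrite Re_mul /= mul0r subr0.
  by rewrite Im_mul /= mul0r addr0.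
set a := fun n => 4 ^+ n * \int[mu]_(y in next_cell x n) complex.Re (f y).
set b := fun n => 4 ^+ n * \int[mu]_(y in next_cell x n) complex.Im (f y).
have ab : (fun n => (a n - complex.Re (f x)) ^+ 2 +
    (b n - complex.Im (f x)) ^+ 2) @ \oo --> (0 + 0 : R).
  by apply: cvgD; exact: sqr_dist_cvg0.
rewrite addr0 in ab; apply: cvg_trans ab.
apply: near_eq_cvg; near=> n.
have [x1 xn] : 1 <= x * 4 ^+ n /\ x < 4 ^+ n by near: n; exact: near_next_cell.
by rewrite avgE// sqr_normcE; case: (f x).
Unshelve. all: by end_near. Qed.

(** Bounded functions with bounded support: differentiation gives pointwise
    convergence. Averaging to the right keeps the support of the averages
    inside that of the function, so that domination is immediate. *)
Lemma shift_avg_bounded_cvg f (M : R) : L2 f -> 0 <= M ->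
  (forall x, normc (f x) <= M) -> (forall x, M < x -> f x = 0) ->
  (fun n => L2norm (fun x => shift_avg n f x - f x)) @ \oo --> (0 : R).
Proof.
move=> Lf M0 fM fs.
pose I : set (measurableTypeR R) := [set` `]0, M]].
have mI : measurable I by exact: measurable_itv.
have IR : I `<=` Rplus.
  by move=> x; rewrite /I /Rplus /= !in_itv/= andbT => /andP[].
have muI : (mu I < +oo)%E.
  by rewrite lebesgue_measure_itv/=; case: ifP => _; rewrite ?ltry.
have cf : cL1 f.
  have ib := integrableZl mRplus M (integrable_indic_on mI IR muI).
  apply: (@cL1_le _ f (fun x => M * \1_I x) _ ib); first by case: Lf.
  move=> x px; rewrite indicE; case: (leP x M) => xM; last first.
    by rewrite fs// complex.ComplexField.Normc.normc0 mulr_ge0.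
  rewrite mem_set ?mulr1//.
  by move: px; rewrite /I /Rplus /= !in_itv/= xM !andbT.
have avgM n x : normc (shift_avg n f x) <= 2 * M.
  have [[k kN kx]|kx] := pselect (exists2 k, (k < shift_size n)%N &
      cell n k.+1 x); last first.
    rewrite shift_avg0 ?complex.ComplexField.Normc.normc0 ?mulr_ge0// => k kN.
    by move=> ckx; apply: kx; exists k.
  have [ir ii] := integrable_on_of_L2 (@measurable_cell n k.+2)
    (@cell_Rplus n k.+2 isT) (mu_cell_fin n k.+2) Lf.
  rewrite (shift_avgE Lf kx kN) complex.ComplexField.Normc.normcM normcr.
  rewrite ger0_norm ?exprn_ge0//.
  have aux (u : R -> R) : mu.-integrable (cell n k.+2) (EFin \o u) ->
      (forall y, `|u y| <= M) ->
      `|\int[mu]_(y in cell n k.+2) u y| <= M * 4^-1 ^+ n.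
    move=> iu uM; have mc := @measurable_cell n k.+2.
    rewrite (le_trans (le_normr_Rintegral mc iu))//.
    rewrite [leRHS](_ : _ = \int[mu]_(y in cell n k.+2) M); last first.
      rewrite Rintegral_cst//; congr (_ * _).
      exact: esym (congr1 fine (mu_cell n k.+2)).
    apply: le_Rintegral => //; first exact: integrable_norm iu.
    exact: integrable_cst_on (mu_cell_fin _ _) _.
  rewrite -ler_pdivlMl ?exprn_gt0// (le_trans (normc_le_ReIm _))//=.
  have -> : (4 ^+ n)^-1 * (2 * M) = M * 4^-1 ^+ n + M * 4^-1 ^+ n.
    by rewrite exprVn; ring.
  by apply: lerD; apply: aux => // y; [exact: le_trans (normc_Re _) (fM y)|
    exact: le_trans (normc_Im _) (fM y)].
have avgs n x : M < x -> shift_avg n f x = 0.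
  move=> Mx; have [[k kN kx]|kx] := pselect (exists2 k, (k < shift_size n)%N &
      cell n k.+1 x); last first.
    by apply: shift_avg0 => k kN ckx; apply: kx; exists k.
  rewrite (shift_avgE Lf kx kN).
  have f0 y : y \in cell n k.+2 -> f y = 0.
    move=> /set_mem/cellP/andP[ky _]; apply: fs; apply: (lt_trans Mx).
    move/cellP : kx => /andP[_ /lt_le_trans/(_ ky)].
    by rewrite ltr_pM2r// exprn_gt0.
  have mc := @measurable_cell n k.+2.
  rewrite /cintegral_on; apply: complex_ext.
    rewrite Re_mul /= mul0r subr0; under eq_Rintegral do rewrite f0//=.
    by rewrite Rintegral_cst// mul0r mulr0.
  rewrite Im_mul /= mul0r addr0; under eq_Rintegral do rewrite f0//=.
  by rewrite Rintegral_cst// mul0r mulr0.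
apply: (@L2norm_dominated_cvg0 _ _ (fun x => 9 * M ^+ 2 * \1_I x)).
- by move=> n; apply: L2_sub => //; exact: L2_shift_avg.
- exact: (integrableZl mRplus _ (integrable_indic_on mI IR muI)).
- move=> n x px; rewrite indicE; case: (leP x M) => xM; last first.
    rewrite avgs// fs// subrr complex.ComplexField.Normc.normc0 expr0n.
    by rewrite mulr_ge0// mulr_ge0// sqr_ge0.
  rewrite mem_set ?mulr1; last first.
    by move: px; rewrite /I /Rplus /= !in_itv/= xM !andbT.
  rewrite (_ : 9 * M ^+ 2 = (2 * M + M) ^+ 2); last by ring.
  rewrite ler_pXn2r ?nnegrE ?normc_ge0 ?addr_ge0 ?mulr_ge0//.
  by rewrite (le_trans (le_normcD _ _))// normcN lerD.
- exact: shift_avg_cvg.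
Qed.

Section truncation.
Variable f : R -> C.
Hypothesis Lf : L2 f.

Let E (k : nat) : set (measurableTypeR R) :=
  Rplus `&` [set x | (normc (f x) ^+ 2)%:E <= k%:R%:E]%E `&` `]-oo, k%:R].

Let mE k : measurable (E k).
Proof.
apply: measurableI; last exact: measurable_itv.
apply: (emeasurable_fun_infty_c mRplus); apply/measurable_EFinP.
by apply: cmeasurable_sqnorm; case: Lf.
Qed.

Lemma truncation_cvg : exists2 g : nat -> R -> C,
  forall k, [/\ L2 (g k), forall x, normc (g k x) <= k%:R
    & forall x, k%:R < x -> g k x = 0] &
  (fun k => L2norm (fun x => f x - g k x)) @ \oo --> (0 : R).
Proof.
exists (fun k => restr (E k) f) => [k|].
  split; first exact: L2_restr.
    move=> x; rewrite normc_restr indicE; case: (boolP (x \in E k)) => [|_].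
      move=> /set_mem[[_ /=]]; rewrite lee_fin mul1r => fk _.
      rewrite -(@ler_pXn2r _ 2)// ?nnegrE ?normc_ge0// (le_trans fk)//.
      by rewrite -natrX ler_nat; case: (k) => // m; rewrite expnS leq_pmulr.
    by rewrite mul0r.
  move=> x kx; rewrite /restr indicE memNset ?mul0r// => -[_] /=.
  by rewrite in_itv/= leNgt kx.
apply: (@L2norm_dominated_cvg0 _ _ (fun x => normc (f x) ^+ 2)).
- by move=> k; apply: L2_sub => //; exact: L2_restr.
- exact: L2_integrable.
- move=> k x _; rewrite /restr indicE; case: (_ \in _).
    by rewrite mul1r subrr complex.ComplexField.Normc.normc0 expr0n sqr_ge0.
  by rewrite mul0r subr0.
- apply: aeW => x px; apply: cvg_near_cst; near=> k.
  rewrite /restr indicE mem_set ?mul1r ?subrr.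
    by rewrite complex.ComplexField.Normc.normc0 expr0n.
  split; first split => //=.
    by rewrite lee_fin; near: k; exact: nbhs_infty_ger.
  by rewrite /= in_itv/=; near: k; exact: nbhs_infty_ger.
Unshelve. all: by end_near. Qed.

End truncation.

(** The averages are contractions, so it suffices to approximate by the
    truncations, for which convergence is already known. *)
Theorem shift_approx_identity :
  approx_identity shift_out shift_in shift_size.
Proof.
split=> [n|n|f Lf]; [exact: cell_orthocontractive..|].
have [g gP fg] := truncation_cvg Lf.
apply/cvgrPdist_le => e e0; have e3 : 0 < e / 3 by rewrite divr_gt0.
move/cvgrPdist_le : fg => /(_ _ e3) [k _ /(_ k (leqnn k))] /=.
rewrite sub0r normrN ger0_norm ?L2norm_ge0// => fgk.
have [Lg gM g0] := gP k.
have := shift_avg_bounded_cvg Lg (ler0n _ _) gM g0.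
move/cvgrPdist_le => /(_ _ e3); apply: filterS => n /=.
rewrite sub0r normrN ger0_norm ?L2norm_ge0// => gn.
rewrite sub0r normrN ger0_norm ?L2norm_ge0//.
have LA := L2_shift_avg n.
rewrite (le_trans (L2norm_sub_trans Lf Lg (LA f)))//.
have -> : e = e / 3 + (e / 3 + e / 3) by field.
rewrite lerD// (le_trans (L2norm_sub_trans Lg (LA (g k)) (LA f)))//.
rewrite lerD//; first by rewrite L2norm_subC.
have -> : (fun x => shift_avg n (g k) x - shift_avg n f x) =
    shift_avg n (fun x => g k x - f x).
  apply/funext => x; rewrite /shift_avg -sumrB; apply: eq_bigr => i _.
  by rewrite L2dotBl ?mulrBl//; exact: L2_shift_in.
by rewrite (le_trans (L2norm_shift_avg_le n (L2_sub Lg Lf)))// L2norm_subC.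
Qed.

End Cells.

(** * The kernel of the operator off the diagonal *)

Section Kernel.
Context {R : realType}.
Local Notation C := R[i].
Local Notation mu := (@lebesgue_measure R).
Local Notation normc := complex.ComplexField.Normc.normc.
Implicit Types (f g h : R -> C) (z w : C).

Lemma L2_ae f g : L2 f -> cmeasurable g -> eqL2 f g -> L2 g.
Proof.
move=> [mf fi] mg fg; split => //; move: fi.
rewrite (@ae_eq_integral _ _ _ mu Rplus (fun x => (normc (g x) ^+ 2)%:E))//.
- exact: mRplus.
- by apply/measurable_EFinP; exact: cmeasurable_sqnorm.
- by apply/measurable_EFinP; exact: cmeasurable_sqnorm.
- by move: fg; apply: filterS => x /[apply] ->.
Qed.

Definition Ico (a b : R) : set (measurableTypeR R) := [set` `[a, b[].

Lemma measurable_Ico a b : measurable (Ico a b).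
Proof. exact: measurable_itv. Qed.

Lemma mu_Ico a b : a <= b -> mu (Ico a b) = (b - a)%:E.
Proof.
move=> ab; rewrite /Ico lebesgue_measure_itv/= lte_fin -EFinD.
by case: ltgtP ab => // -> _; rewrite subrr.
Qed.

Lemma mu_Ico_fin a b : (mu (Ico a b) < +oo)%E.
Proof. by rewrite lebesgue_measure_itv/=; case: ifP => _; rewrite ?ltry. Qed.

Lemma Ico_Rplus a b : 0 < a -> Ico a b `<=` Rplus.
Proof.
move=> a0 x; rewrite /Ico /Rplus /= !in_itv/= andbT => /andP[ax _].
exact: lt_le_trans ax.
Qed.

(** On a rectangle below the diagonal the kernel depends on one variable only,
    so that [Q_op] acts there as a rank-one operator. *)
Lemma Q_op_rindic phi c a b x : 0 < a -> a <= b -> b <= x ->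
  Q_op phi (rindic c (Ico a b)) x = (c * (b - a))%:C%C * phi x.
Proof.
move=> a0 ab bx.
have mA := measurable_Ico a b; have AR := @Ico_Rplus a b a0.
have Af := mu_Ico_fin a b.
have E y : phi (Num.max x y) * rindic c (Ico a b) y =
    phi x * rindic c (Ico a b) y.
  rewrite /rindic indicE; case: (boolP (y \in _)) => [|_].
    rewrite inE /Ico /= in_itv/= => /andP[_ yb].
    by rewrite max_l// (le_trans (ltW yb)).
  by rewrite mulr0 rmorph0 !mulr0.
have muE : fine (mu (Ico a b)) = b - a by rewrite mu_Ico.
have I (r : R) : \int[mu]_(y in Rplus) (c * (r * \1_(Ico a b) y)) =
    c * (r * (b - a)).
  rewrite (Rintegral_indic mA AR c (integrable_cst_on mA Af r)).
  by rewrite Rintegral_cst// muE.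
rewrite /Q_op /cintegral; apply: complex_ext; rewrite ?Re_mul ?Im_mul /=.
  rewrite mul0r subr0 -mulrA [(b - a) * _]mulrC -I; apply: eq_Rintegral => y _.
  by rewrite E Re_mul /=; ring.
rewrite mul0r addr0 -mulrA [(b - a) * _]mulrC -I; apply: eq_Rintegral => y _.
by rewrite E Im_mul /=; ring.
Qed.

Lemma rindic_bounded_compact_support c a b : 0 < a ->
  bounded_compact_support (rindic c (Ico a b)).
Proof.
move=> a0; split.
- have [] // := L2_rindic (measurable_Ico a b) (@Ico_Rplus a b a0)
    (mu_Ico_fin a b) c.
- exists `|c| => x _; rewrite normcr normrM ler_piMr// indicE.
  by case: (_ \in _); rewrite ?normr1 ?normr0.
- exists `[a, b]%classic; split; first exact: segment_compact.
    move=> x; rewrite /Rplus /= !in_itv/= andbT => /andP[ax _].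
    exact: lt_le_trans ax.
  move=> x _ xab; rewrite /rindic indicE memNset ?mulr0// => xI; apply: xab.
  by move: xI; rewrite /Ico /= !in_itv/= => /andP[-> /ltW].
Qed.

Section extension.
Variables (phi : R -> C) (T : (R -> C) -> R -> C).
Hypotheses (philoc : cL1loc phi) (TQ : extends_Q phi T).

Lemma cmeasurable_phi : cmeasurable phi.
Proof. by case: philoc => -[m1 _ _] [m2 _ _]. Qed.

Lemma L2_T f : L2 f -> L2 (T f).
Proof. by case: TQ => -[LT _ _] _; exact: LT. Qed.

Lemma cmeasurable_restr (B : set (measurableTypeR R)) f :
  measurable B -> cmeasurable f -> cmeasurable (restr B f).
Proof. by move=> mB mf; apply: cmeasurable_mul => //; exact: cmeasurable_indic. Qed.

Section block.
Variables (c a b : R) (B : set (measurableTypeR R)).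
Hypotheses (c0 : 0 < c) (a0 : 0 < a) (ab : a < b).
Hypotheses (mB : measurable B) (bB : forall x, B x -> b <= x).

Let LA : L2 (rindic c (Ico a b)).
Proof.
by apply: L2_rindic; [exact: measurable_Ico|exact: Ico_Rplus|exact: mu_Ico_fin].
Qed.

Let T_rindic : eqL2 (restr B (T (rindic c (Ico a b))))
  (fun x => (c * (b - a))%:C%C * restr B phi x).
Proof.
have [_ /(_ _ (rindic_bounded_compact_support c b a0))] := TQ.
apply: filterS => x TE px; rewrite /restr TE// indicE.
case: (boolP (x \in B)) => [/set_mem/bB bx|_]; last by rewrite !mul0r mulr0.
by rewrite (Q_op_rindic _ _ a0 (ltW ab) bx) !mul1r.
Qed.

(** Square integrability of [phi] away from the origin comes from the fact that
    the operator has values in [L2]. *)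
Lemma L2_restr_phi : L2 (restr B phi).
Proof.
have k0 : (c * (b - a))%:C%C != 0 :> C.
  by apply/eqP => -[] /eqP; rewrite mulf_eq0 gt_eqF// subr_eq0 gt_eqF.
have LT := L2_restr mB (L2_T LA).
apply: (L2_ae (L2_scale ((c * (b - a))%:C%C)^-1 LT)).
  by apply: cmeasurable_restr => //; exact: cmeasurable_phi.
by have := T_rindic; apply: filterS => x /[apply] ->; rewrite mulKf.
Qed.

Lemma T_block g : L2 g ->
  L2dot (T (rindic c (Ico a b))) (restr B g) =
  (c * (b - a))%:C%C * L2dot (restr B phi) g.
Proof.
move=> Lg; have Lp := L2_restr_phi.
have -> : L2dot (T (rindic c (Ico a b))) (restr B g) =
    L2dot (restr B (T (rindic c (Ico a b)))) g.
  rewrite /L2dot; congr cintegral; apply/funext => x.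
  by rewrite /restr rmorphM/= conjc_real; ring.
rewrite -L2dotZl//; apply: eq_L2dotl => //.
  by apply: L2_restr => //; exact: L2_T.
exact: L2_scale.
Qed.

End block.

Section sign.
Variable sgn : R -> R.
Hypotheses (msgn : measurable_fun (Rplus : set (measurableTypeR R)) sgn)
  (sgn1 : forall x, sgn x * sgn x = 1).

Definition sign_mul f : R -> C := fun x => (sgn x)%:C%C * f x.

Lemma normc_sign_mul f x : normc (sign_mul f x) = normc (f x).
Proof.
have : `|sgn x| ^+ 2 = 1 by rewrite real_normK ?num_real// expr2.
move/eqP; rewrite sqrf_eq1 => s1.
rewrite complex.ComplexField.Normc.normcM normcr.
by case/orP : s1 => /eqP s1; [rewrite s1 mul1r|have := normr_ge0 (sgn x); lra].
Qed.

Lemma L2_sign_mul f : L2 f -> L2 (sign_mul f).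
Proof.
move=> Lf; apply: (@le_L2 _ _ (fun x => normc (f x) ^+ 2)).
- by apply: cmeasurable_mul; [split => //=; exact: measurable_cst|case: Lf].
- exact: L2_integrable.
- by move=> x _; rewrite normc_sign_mul.
Qed.

Lemma L2dot_sign_mul2 f g : L2dot (sign_mul f) (sign_mul g) = L2dot f g.
Proof.
rewrite /L2dot; congr cintegral; apply/funext => x.
rewrite /sign_mul rmorphM/= conjc_real mulrACA -rmorphM/= sgn1 rmorph1.
by rewrite mul1r.
Qed.

Lemma L2dot_sign_mul f g : L2dot f (sign_mul g) = L2dot (sign_mul f) g.
Proof.
rewrite /L2dot; congr cintegral; apply/funext => x.
by rewrite /sign_mul rmorphM/= conjc_real; ring.
Qed.

Lemma sign_mul_orthocontractive (I : eqType) (e : I -> R -> C) :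
  orthocontractive e -> orthocontractive (fun i => sign_mul (e i)).
Proof.
move=> [Le eo e1]; split=> [i|i j ij|i]; first exact: L2_sign_mul.
  by rewrite L2dot_sign_mul2 eo.
rewrite (_ : L2norm _ = L2norm (e i))//.
by congr Num.sqrt; apply: eq_Rintegral => x _; rewrite normc_sign_mul.
Qed.

(** The cell carrying [shift_in] lies to the right of the one carrying
    [shift_out], so the block formula applies; the normalizations cancel. *)
Lemma L2dot_T_shift n i :
  L2dot (T (shift_out n i)) (sign_mul (shift_in n i)) =
  cintegral_on (cell n (i + 2)) (sign_mul phi).
Proof.
pose q : R := 4^-1 ^+ n; have q0 : 0 < q by rewrite exprn_gt0.
pose a := i.+1%:R * q; pose b := i.+2%:R * q.
have ab : a < b by rewrite ltr_pM2r// ltr_nat.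
have a0 : 0 < a by rewrite mulr_gt0.
have mB := @measurable_cell R n (i + 2).
have bB x : cell n (i + 2) x -> b <= x.
  by rewrite addn2 /cell /= in_itv/= => /andP[].
have c0 : 0 < 2 ^+ n :> R by rewrite exprn_gt0.
have -> : shift_out n i = rindic (2 ^+ n) (Ico a b) by rewrite /shift_out addn1.
have -> : sign_mul (shift_in n i) =
    restr (cell n (i + 2)) (sign_mul (shift_in n i)).
  apply/funext => x; rewrite /restr /sign_mul /shift_in /rindic indicE.
  by case: (x \in _); [rewrite mul1r|rewrite mulr0 rmorph0 mulr0 mul0r].
have Lin := @L2_shift_in R n i.
rewrite (T_block c0 a0 ab mB bB)//; last exact: L2_sign_mul.
have Lp := L2_restr_phi c0 a0 ab mB bB.
rewrite L2dot_sign_mul L2dot_shift_in; last exact: L2_sign_mul.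
rewrite mulrA -rmorphM/=.
have -> : 2 ^+ n * (b - a) * 2 ^+ n = 1.
  rewrite /a /b -mulrBl -natrB// subSnn mul1r mulrAC -exprMn -exprMn.
  by rewrite (_ : 2 * 2 * 4^-1 = 1) ?expr1n//; field.
rewrite rmorph1 mul1r /cintegral_on; congr Complex;
  apply: eq_Rintegral => x xc;
  by rewrite /sign_mul /restr indicE xc mul1r.
Qed.

End sign.

End extension.

End Kernel.

(** * Integrability, the trace and the dyadic sums *)

Section Conclusions.
Context {R : realType}.
Local Notation C := R[i].
Local Notation mu := (@lebesgue_measure R).
Local Notation normc := complex.ComplexField.Normc.normc.
Implicit Types (f g h : R -> C) (z w : C).

(** The union of the cells of size [4^-1 ^+ n] with indices from [2] to [m + 1],
    on which the trace sums at stage [n] integrate [phi]. *)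
Definition window n m : set (measurableTypeR R) :=
  Ico (2 * 4^-1 ^+ n) ((m + 2)%:R * 4^-1 ^+ n).

Lemma window_Rplus n m : window n m `<=` Rplus.
Proof. by apply: Ico_Rplus; rewrite mulr_gt0// exprn_gt0. Qed.

Lemma sum_Rintegral_cell n m (u : R -> R) :
  mu.-integrable (window n m) (EFin \o u) ->
  \sum_(0 <= i < m) \int[mu]_(x in cell n (i + 2)) u x =
  \int[mu]_(x in window n m) u x.
Proof.
have q0 : 0 < 4^-1 ^+ n :> R by rewrite exprn_gt0.
elim: m => [|m IH] iu.
  rewrite big_nil /window add0n /Ico set_itv_ge ?Rintegral_set0//.
  by rewrite bnd_simp ltxx.
have wS : window n m.+1 = window n m `|` cell n (m + 2).
  rewrite /window /Ico /cell addSn (@itv_bndbnd_setU _ _ _ (BLeft ((m + 2)%:R * 4^-1 ^+ n)))//.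
    by rewrite bnd_simp ler_pM2r// ler_nat addn2.
  by rewrite bnd_simp ler_pM2r// ler_nat.
have mw := measurable_Ico (2 * 4^-1 ^+ n : R) ((m + 2)%:R * 4^-1 ^+ n).
have mc := @measurable_cell R n (m + 2).
rewrite big_nat_recr//= IH; last first.
  apply: (integrableS _ mw _ iu); first exact: measurable_Ico.
  by rewrite wS; exact: subsetUl.
rewrite wS Rintegral_setU//; first by rewrite -wS.
apply/disj_setPS => x [] /=; rewrite /window /Ico /cell /= !in_itv/=.
by move=> /andP[_ xm] /andP[]; rewrite leNgt xm.
Qed.

Lemma locally_integrable_window n m (u : R -> R) :
  locally_integrable Rplus u -> mu.-integrable (window n m) (EFin \o u).
Proof.
move=> [mu' _ iu].
have mw := measurable_Ico (2 * 4^-1 ^+ n : R) ((m + 2)%:R * 4^-1 ^+ n).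
apply/integrableP; split.
  by apply/measurable_EFinP; apply: (measurable_funS mRplus _ mu'); exact: window_Rplus.
pose K : set R := `[2 * 4^-1 ^+ n, (m + 2)%:R * 4^-1 ^+ n]%classic.
have KR : K `<=` Rplus.
  move=> x; rewrite /K /Rplus /= !in_itv/= andbT => /andP[+ _].
  by apply: lt_le_trans; rewrite mulr_gt0// exprn_gt0.
have mK : measurable (K : set (measurableTypeR R)) by exact: measurable_itv.
apply: le_lt_trans (iu K KR (@segment_compact _ _ _)).
apply: ge0_subset_integral => //.
  by apply/measurable_EFinP; apply: measurableT_comp => //;
    apply: (measurable_funS mRplus KR mu').
by move=> x; rewrite /window /Ico /K /= !in_itv/= => /andP[-> /ltW].
Qed.

Lemma near_window (x : R) : 0 < x -> \forall n \near \oo,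
  2 * 4^-1 ^+ n <= x /\ x < (shift_size n + 2)%:R * 4^-1 ^+ n.
Proof.
move=> x0; near=> n.
have q0 : 0 < 4^-1 ^+ n :> R by rewrite exprn_gt0.
have [x1 xn] : 1 <= x / 2 * 4 ^+ n /\ x / 2 < 4 ^+ n.
  by near: n; apply: near_next_cell; rewrite divr_gt0.
have [_ xn'] : 1 <= x * 4 ^+ n /\ x < 4 ^+ n by near: n; exact: near_next_cell.
have e4 : 4 ^+ n * 4^-1 ^+ n = 1 :> R by rewrite -exprMn mulfV// expr1n.
split.
  have := ler_wpM2r (ltW q0) x1.
  by rewrite -[_ * 4 ^+ n * _]mulrA [4 ^+ n * _]e4; lra.
rewrite (lt_le_trans xn')// (_ : 4 ^+ n = 16 ^+ n * 4^-1 ^+ n :> R).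
  by rewrite ler_pM2r// natrD natrX lerDl.
by rewrite -exprMn; congr (_ ^+ _); field.
Unshelve. all: by end_near. Qed.

Section conclusions.
Variables (phi : R -> C) (T : (R -> C) -> R -> C).
Hypotheses (philoc : cL1loc phi) (TQ : extends_Q phi T) (tT : trace_class T).

(** The windows exhaust the half-line; nested intervals, each contained in some
    window, allow monotone convergence to be used. *)
Lemma integrable_of_window_bound (u : R -> R) (B : R) :
  locally_integrable Rplus u ->
  (forall n, \int[mu]_(x in window n (shift_size n)) `|u x| <= B) ->
  mu.-integrable Rplus (EFin \o u).
Proof.
move=> lu uB; have [mu' _ _] := lu.
apply/integrableP; split; first exact/measurable_EFinP.
pose K m : set (measurableTypeR R) := Ico m.+1%:R^-1 m.+1%:R.
have KR m : K m `<=` Rplus by apply: Ico_Rplus; rewrite invr_gt0.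
have -> : Rplus = \bigcup_m K m.
  apply/seteqP; split=> [x|x [m _ /KR//]].
  rewrite {1}/Rplus /= in_itv/= andbT => x0.
  pose m := maxn (Num.bound x) (Num.bound x^-1).
  have xV0 : 0 < x^-1 by rewrite invr_gt0.
  exists m => //; rewrite /K /Ico /= in_itv/=; apply/andP; split.
    rewrite -[leRHS]invrK lef_pV2 ?posrE//.
    rewrite (le_trans (ltW (archi_boundP (ltW xV0))))// ler_nat ltnW// ltnS.
    exact: leq_maxr.
  rewrite (lt_le_trans (archi_boundP (ltW x0)))// ler_nat ltnW// ltnS.
  exact: leq_maxl.
have mK m : measurable (K m) by exact: measurable_Ico.
have mau m : measurable_fun (K m) (fun x => `|(u x)%:E|%E).
  apply: measurableT_comp => //; apply/measurable_EFinP.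
  exact: (measurable_funS mRplus (@KR m) mu').
have nK : nondecreasing_seq K.
  apply/nondecreasing_seqP => m; rewrite subsetEset => x.
  rewrite /K /Ico /= !in_itv/= => /andP[mx xm]; apply/andP; split.
    by rewrite (le_trans _ mx)// lef_pV2 ?posrE// ler_nat.
  by rewrite (lt_trans xm)// ltr_nat.
have cK := @ge0_nondecreasing_set_cvg_integral _ _ R K
  (fun x => `|(u x)%:E|%E) mu nK mK mau (fun _ _ _ => abse_ge0 _).
rewrite -(cvg_lim _ cK)//; apply: (@le_lt_trans _ _ B%:E); last exact: ltry.
apply: lime_le; first by apply/cvg_ex; eexists; exact: cK.
apply: nearW => m.
have m0 : 0 < m.+1%:R :> R by [].
have mV0 : 0 < m.+1%:R^-1 :> R by rewrite invr_gt0.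
have [n [[n1 _] [_ n2]]] :=
  filter_ex (filterI (near_window mV0) (near_window m0)).
have iw := locally_integrable_window n (shift_size n) lu.
apply: (@le_trans _ _ (\int[mu]_(x in window n (shift_size n)) `|(u x)%:E|)%E).
  apply: ge0_subset_integral => //; first exact: measurable_Ico.
    by apply: measurableT_comp => //; exact: measurable_int iw.
  move=> x; rewrite /K /window /Ico /= !in_itv/= => /andP[mx xm].
  by rewrite (le_trans n1)//= (lt_trans xm).
rewrite -[leLHS]fineK ?lee_fin; first exact: uB.
exact: (integrable_fin_num (measurable_Ico _ _) (integrable_abse iw)).
Qed.

Lemma Re_cintegral_on A f :
  complex.Re (cintegral_on A f) = \int[mu]_(x in A) complex.Re (f x).
Proof. by []. Qed.

Lemma Im_cintegral_on A f :
  complex.Im (cintegral_on A f) = \int[mu]_(x in A) complex.Im (f x).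
Proof. by []. Qed.

(** Pairing with a function of modulus one that carries the sign of [u], for
    [u] the real or the imaginary part of [phi], makes all the terms of a trace
    sum nonnegative. *)
Lemma sign_of (u : R -> R) : measurable_fun Rplus u ->
  exists sgn : R -> R, [/\ measurable_fun (Rplus : set (measurableTypeR R)) sgn,
    forall x, sgn x * sgn x = 1 & forall x, Rplus x -> sgn x * u x = `|u x|].
Proof.
move=> mu'; pose P : set (measurableTypeR R) :=
  Rplus `&` [set x | 0%:E <= (u x)%:E]%E.
have mP : measurable P.
  by apply: (emeasurable_fun_c_infty mRplus); exact/measurable_EFinP.
exists (fun x => 2 * \1_P x - 1); split.
- apply: measurable_funB; last exact: measurable_cst.
  by apply: measurable_funM; [exact: measurable_cst|exact: measurable_indic].
- by move=> x; rewrite indicE; case: (x \in P) => /=; ring.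
- move=> x px; rewrite indicE; case: (boolP (x \in P)) => [/set_mem[_ /=]|xP].
    by rewrite lee_fin => u0; rewrite ger0_norm//=; ring.
  have u0 : u x < 0.
    rewrite ltNge; apply/negP => u0; move/negP : xP; apply; apply/mem_set.
    by split => //=; rewrite lee_fin.
  by rewrite ltr0_norm//=; ring.
Qed.

Lemma sum_L2dot_T_shift n (sgn : R -> R) :
  measurable_fun (Rplus : set (measurableTypeR R)) sgn ->
  (forall x, sgn x * sgn x = 1) ->
  \sum_(0 <= i < shift_size n)
    L2dot (T (shift_out n i)) (sign_mul sgn (shift_in n i)) =
  \sum_(0 <= i < shift_size n) cintegral_on (cell n (i + 2)) (sign_mul sgn phi).
Proof. by move=> ms s1; apply: eq_bigr => i _; exact: L2dot_T_shift. Qed.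

(** With the signs inserted, the real (or imaginary) part of a trace sum is the
    integral over a window of the absolute value of that part of [phi], and
    trace sums are bounded. *)
Lemma cL1_phi : cL1 phi.
Proof.
have [lR lI] := philoc.
have [B TB] := trace_class_sum_bounded tT.
have bound n (sgn : R -> R) :
    measurable_fun (Rplus : set (measurableTypeR R)) sgn ->
    (forall x, sgn x * sgn x = 1) ->
    normc (\sum_(0 <= i < shift_size n)
      cintegral_on (cell n (i + 2)) (sign_mul sgn phi)) <= B.
  move=> ms s1; rewrite -sum_L2dot_T_shift//; apply: TB.
  - by have [+ _ _] := @shift_approx_identity R; exact.
  - apply: sign_mul_orthocontractive => //.
    by have [_ + _] := @shift_approx_identity R; exact.
  - exact: iota_uniq.
have cR n i : cell n (i + 2) `<=` (Rplus : set R) by apply: cell_Rplus; rewrite addn2.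
have [[mR _ _] [mI _ _]] := (lR, lI).
split; apply: (@integrable_of_window_bound _ B) => // n.
- have [sgn [ms s1 su]] := sign_of mR.
  rewrite -sum_Rintegral_cell; last first.
    by apply: integrable_norm; exact: locally_integrable_window.
  apply: le_trans (bound n _ ms s1); rewrite (le_trans _ (normc_Re _))//.
  rewrite (le_trans _ (ler_norm _))// Re_sum; apply: ler_sum => i _.
  rewrite Re_cintegral_on le_eqVlt; apply/orP; left; apply/eqP.
  apply: eq_Rintegral => x /set_mem/cR px.
  by rewrite -su// /sign_mul Re_mul /= mul0r subr0.
- have [sgn [ms s1 su]] := sign_of mI.
  rewrite -sum_Rintegral_cell; last first.
    by apply: integrable_norm; exact: locally_integrable_window.
  apply: le_trans (bound n _ ms s1); rewrite (le_trans _ (normc_Im _))//.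
  rewrite (le_trans _ (ler_norm _))// Im_sum; apply: ler_sum => i _.
  rewrite Im_cintegral_on le_eqVlt; apply/orP; left; apply/eqP.
  apply: eq_Rintegral => x /set_mem/cR px.
  by rewrite -su// /sign_mul Im_mul /= mul0r addr0.
Qed.

Lemma Rintegral_window_cvg (u : R -> R) : mu.-integrable Rplus (EFin \o u) ->
  (fun n => \int[mu]_(x in window n (shift_size n)) u x) @ \oo -->
  \int[mu]_(x in Rplus) u x.
Proof.
move=> iu; pose w n := window n (shift_size n).
have mw n : measurable (w n) by exact: measurable_Ico.
have wR n : w n `<=` Rplus by exact: window_Rplus.
have mu' : measurable_fun Rplus (EFin \o u) := measurable_int _ iu.
have [|||||_ _ H] := @dominated_convergence _ _ _ mu Rplus mRplus
  (fun n => EFin \o (u \_ (w n))) (EFin \o u) (fun x => `|(u x)%:E|%E) => //.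
- move=> n; rewrite -restrict_EFin; apply/measurable_restrict => //.
    exact: mRplus.
  by rewrite setIidr//; exact: (measurable_funS mRplus (wR n) mu').
- apply: aeW => x px; apply: cvg_near_cst.
  have x0 : 0 < x by move: px; rewrite /Rplus /= in_itv/= andbT.
  near=> n; rewrite /= patchE mem_set//.
  rewrite /w /window /Ico /= in_itv/=; apply/andP.
  by near: n; exact: near_window.
- exact: integrable_abse.
- apply: aeW => x n px; rewrite /= patchE lee_fin.
  by case: ifP => // _; rewrite normr0.
move: H; under eq_fun do rewrite -restrict_EFin -integral_mkcondr setIidr//.
rewrite -[X in _ --> X](fineK (integrable_fin_num mRplus iu)).
by move=> /fine_cvgP[].
Unshelve. all: by end_near. Qed.

Lemma approx_trace_shift_cvg :
  (fun n => normc (approx_trace shift_out shift_in shift_size T n -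
    cintegral phi)) @ \oo --> (0 : R).
Proof.
have [lR lI] := philoc; have [iR iI] := cL1_phi.
have traceE n : approx_trace shift_out shift_in shift_size T n =
    cintegral_on (window n (shift_size n)) phi.
  have sm1 f : sign_mul (cst 1) f = f.
    by apply/funext => x; rewrite /sign_mul mul1r.
  transitivity (\sum_(0 <= i < shift_size n) cintegral_on (cell n (i + 2)) phi).
    rewrite /approx_trace -[in RHS](sm1 phi) -sum_L2dot_T_shift.
    - by apply: eq_bigr => i _; rewrite sm1.
    - exact: measurable_cst.
    - by move=> x; rewrite /= mulr1.
  apply: complex_ext; rewrite ?Re_sum ?Im_sum /cintegral_on /=.
    by apply: sum_Rintegral_cell; exact: locally_integrable_window.
  by apply: sum_Rintegral_cell; exact: locally_integrable_window.
have HR := Rintegral_window_cvg iR; have HI := Rintegral_window_cvg iI.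
apply/cvgrPdist_le => e e0; have e2 : 0 < e / 2 by rewrite divr_gt0.
move/cvgrPdist_le : HR => /(_ _ e2) HR; move/cvgrPdist_le : HI => /(_ _ e2) HI.
near=> n; rewrite sub0r normrN ger0_norm ?normc_ge0// -normcN opprB traceE.
rewrite (le_trans (normc_le_ReIm _))// [leRHS]splitr lerD//.
  by near: n.
by near: n.
Unshelve. all: by end_near. Qed.

Lemma L2dot_restr_disj (A B : set R) f g : A `&` B = set0 ->
  L2dot (restr A f) (restr B g) = 0.
Proof.
move=> AB; rewrite -(L2dot0l (restr B g)) /L2dot; congr cintegral.
apply/funext => x; rewrite mul0r /restr !indicE.
have [xA|_] := boolP (x \in A); last by rewrite rmorph0 !mul0r.
have [xB|_] := boolP (x \in B); last by rewrite mul0r rmorph0 mulr0.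
have : (A `&` B) x by split; exact/set_mem.
by rewrite AB.
Qed.

Definition dyadic (n : int) : set (measurableTypeR R) :=
  Ico ((2 : R) ^ n) ((2 : R) ^ (n + 1)).

Lemma exp2z_gt0 (n : int) : 0 < (2 : R) ^ n.
Proof. by rewrite exprz_gt0. Qed.

Lemma exp2zS (n : int) : (2 : R) ^ (n + 1) = 2 * 2 ^ n.
Proof. by rewrite expfzDr// expr1z mulrC. Qed.

Lemma dyadic_disj (i j : int) : i != j -> dyadic i `&` dyadic j = set0.
Proof.
wlog ij : i j / (i < j)%R.
  move=> H; case: (ltgtP i j) => // ij _; first by apply: H => //; rewrite lt_eqF.
  by rewrite setIC; apply: H => //; rewrite lt_eqF.
move=> _; apply/seteqP; split => // x [].
rewrite /dyadic /Ico /= !in_itv/= => /andP[_ xi] /andP[jx _].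
have : (2 : R) ^ (i + 1) <= 2 ^ j by rewrite ler_eXz2l ?lezD1// ltr1n.
by move=> /(lt_le_trans xi) /lt_le_trans /(_ jx); rewrite ltxx.
Qed.

(** The two families that test the blocks of the operator sending functions on
    one dyadic interval to functions on the next. When [phi] vanishes on the
    interval, the inverse of zero makes the vector null, which is harmless since
    the families are only required to lie in the unit ball. *)
Definition dyadic_in n : R -> C :=
  rindic (Num.sqrt ((2 : R) ^ (n - 1)))^-1 (dyadic (n - 1)).

Definition dyadic_norm n : R := L2norm (restr (dyadic n) phi).

Definition dyadic_out n : R -> C :=
  fun x => (dyadic_norm n)^-1%:C%C * restr (dyadic n) phi x.

Let ab n : (2 : R) ^ (n - 1) < 2 ^ (n - 1 + 1).
Proof. by rewrite exp2zS; have := exp2z_gt0 (n - 1); lra. Qed.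

Let c0 n : 0 < (Num.sqrt ((2 : R) ^ (n - 1)))^-1.
Proof. by rewrite invr_gt0 sqrtr_gt0 exp2z_gt0. Qed.

Let bB n x : dyadic n x -> (2 : R) ^ (n - 1 + 1) <= x.
Proof. by rewrite subrK /dyadic /Ico /= in_itv/= => /andP[]. Qed.

Let mD n : measurable (dyadic n).
Proof. exact: measurable_Ico. Qed.

Lemma L2_dyadic n : L2 (restr (dyadic n) phi).
Proof.
exact: (L2_restr_phi philoc TQ (c0 n) (exp2z_gt0 _) (ab n) (mD n) (@bB n)).
Qed.

Lemma L2dot_T_dyadic n : L2dot (T (dyadic_in n)) (dyadic_out n) =
  (Num.sqrt ((2 : R) ^ (n - 1)) * dyadic_norm n)%:C%C.
Proof.
have Lp := L2_dyadic n; have Lo : L2 (dyadic_out n) by exact: L2_scale.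
have -> : dyadic_out n = restr (dyadic n) (dyadic_out n).
  apply/funext => x; rewrite /dyadic_out /restr indicE.
  by case: (x \in _); rewrite ?mul1r// !mul0r mulr0.
rewrite /dyadic_in (T_block philoc TQ (c0 n) (exp2z_gt0 _) (ab n) (mD n) (@bB n))//.
rewrite /dyadic_out L2dotZr// L2dotff conjc_real -!rmorphM/=; congr (_%:C)%C.
rewrite exp2zS; set p := (2 : R) ^ (n - 1); set w := dyadic_norm n.
have p0 : 0 < p by exact: exp2z_gt0.
have -> : 2 * p - p = Num.sqrt p * Num.sqrt p.
  by rewrite -expr2 sqr_sqrtr ?ltW//; ring.
rewrite mulKf ?gt_eqF ?sqrtr_gt0//.
rewrite -/(dyadic_norm n) -/w.
by have [->|w0] := eqVneq w 0; [rewrite expr0n !mulr0|rewrite expr2 mulKf].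
Qed.

Lemma dyadic_sum_bounded : exists B : R, forall s : seq int, uniq s ->
  \sum_(n <- s) Num.sqrt ((2 : R) ^ (n - 1)) * dyadic_norm n <= B.
Proof.
have [B TB] := trace_class_sum_bounded tT; exists B => s us.
have DR n : dyadic n `<=` Rplus by apply: Ico_Rplus; exact: exp2z_gt0.
have oin : orthocontractive dyadic_in.
  split=> [n|i j ij|n].
  - by apply: L2_rindic => //; exact: mu_Ico_fin.
  - apply: L2dot_rindic_disj; apply: dyadic_disj.
    by apply: contra ij => /eqP/addIr ->.
  - rewrite -(@ler_pXn2r _ 2)// ?nnegrE ?L2norm_ge0// expr1n.
    rewrite sqr_L2norm_rindic//; last exact: mu_Ico_fin.
    rewrite mu_Ico ?(ltW (ab n))//= exp2zS exprVn.
    rewrite sqr_sqrtr ?(ltW (exp2z_gt0 _))//.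
    by rewrite ler_pdivrMl ?exp2z_gt0//; lra.
have oout : orthocontractive dyadic_out.
  have Ld := L2_dyadic; split=> [n|i j ij|n]; first exact: L2_scale.
    rewrite L2dotZl//; last exact: L2_scale.
    by rewrite L2dotZr// L2dot_restr_disj ?dyadic_disj// !mulr0.
  rewrite L2normZ// normcr ger0_norm ?invr_ge0 ?L2norm_ge0//.
  rewrite -/(dyadic_norm n).
  by have [->|w0] := eqVneq (dyadic_norm n) 0; rewrite ?invr0 ?mul0r// mulVf.
apply: le_trans (TB _ _ _ _ oin oout us).
under [in leRHS]eq_bigr do rewrite L2dot_T_dyadic.
by rewrite -rmorph_sum normcr ler_norm.
Qed.

(** The terms of the series defining [X1] are, up to the factor [Num.sqrt 2], the
    terms of the trace sums of the dyadic families. *)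
Lemma X1_phi : X1 phi.
Proof.
split; first exact: (cmeasurable_phi philoc).
have [B dB] := dyadic_sum_bounded.
have DR n : dyadic n `<=` Rplus by apply: Ico_Rplus; exact: exp2z_gt0.
have termE n : ((2 `^ (n%:~R / 2))%:E *
    (\int[mu]_(x in `[(2 : R) ^ n, (2 : R) ^ (n + 1)])
       ((normc (phi x)) ^+ 2)%:E) `^ 2^-1)%E =
    (Num.sqrt 2 * (Num.sqrt ((2 : R) ^ (n - 1)) * dyadic_norm n))%:E.
  have -> : (\int[mu]_(x in `[(2 : R) ^ n, (2 : R) ^ (n + 1)])
       ((normc (phi x)) ^+ 2)%:E = (dyadic_norm n ^+ 2)%:E)%E.
    have ms : measurable_fun (dyadic n) (fun x => (normc (phi x) ^+ 2)%:E).
      apply/measurable_EFinP; apply: (measurable_funS mRplus (DR n)).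
      exact: cmeasurable_sqnorm (cmeasurable_phi philoc).
    rewrite -(integral_itv_bndo_bndc ms) /dyadic_norm sqr_L2normE; last first.
      exact: L2_dyadic.
    transitivity (\int[mu]_(x in Rplus `&` dyadic n) (normc (phi x) ^+ 2)%:E)%E.
      by rewrite setIidr.
    rewrite integral_mkcondr.
    apply: eq_integral => x _; rewrite patchE normc_restr indicE.
    by case: (x \in dyadic n); rewrite ?mul1r// mul0r expr0n.
  rewrite poweR_EFin -EFinM; congr EFin.
  rewrite powRrM powR_intmul// !powR12_sqrt ?sqr_ge0//; last first.
    by rewrite ltW// exp2z_gt0.
  rewrite sqrtr_sqr ger0_norm ?L2norm_ge0// mulrA -sqrtrM//.
  by rewrite -exp2zS subrK.
apply: (@le_lt_trans _ _ (Num.sqrt 2 * B)%:E); last exact: ltry.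
apply: ge_ereal_sup => _ [A [finA _] <-].
rewrite fsbig_finite//=; under eq_bigr do rewrite termE.
rewrite sumEFin lee_fin -mulr_sumr ler_wpM2l ?sqrtr_ge0//.
by apply: dB; exact: finmap.fset_uniq.
Qed.

(** The partial sums along an orthonormal basis and the integrals of [phi] over
    windows are trace sums for two approximations of the identity. *)
Lemma is_trace_phi : is_trace T (cintegral phi).
Proof.
move=> e be; have ai := orthonormal_basis_approx_identity be.
have d1 := approx_trace_unique tT ai (@shift_approx_identity R).
have d2 := approx_trace_shift_cvg.
have H : (fun n => normc (\sum_(0 <= i < n) L2dot (T (e i)) (e i) -
    cintegral phi)) @ \oo --> (0 : R).
  apply/cvgrPdist_le => d d0; have dd : 0 < d / 2 by rewrite divr_gt0.
  move/cvgrPdist_le : d1 => /(_ _ dd) d1.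
  move/cvgrPdist_le : d2 => /(_ _ dd); move: d1; apply: filterS2 => n.
  rewrite !sub0r !normrN !ger0_norm ?normc_ge0// => n1 n2.
  set s := approx_trace shift_out shift_in shift_size T n in n1 n2.
  rewrite -(subrK s (\sum_(0 <= i < n) _)) -addrA.
  by rewrite (le_trans (le_normcD _ _))// [leRHS]splitr lerD.
have cvgb (u : nat -> R) (l : R) :
    (forall n, `|u n - l| <= normc (\sum_(0 <= i < n) L2dot (T (e i)) (e i) -
      cintegral phi)) -> u @ \oo --> l.
  move=> ul; apply/cvgrPdist_le => d d0.
  move/cvgrPdist_le : H => /(_ _ d0); apply: filterS => n.
  rewrite sub0r normrN ger0_norm ?normc_ge0// distrC; exact: le_trans.
split; apply: cvgb => n.
  by apply: le_trans (normc_Re _); rewrite Re_sub Re_sum.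
by apply: le_trans (normc_Im _); rewrite Im_sub Im_sum.
Qed.

End conclusions.

End Conclusions.

Theorem theorem6p2 (R : realType) (phi : R -> R[i])
    (T : (R -> R[i]) -> (R -> R[i])) :
  cL1loc phi ->
  extends_Q phi T ->
  trace_class T ->
  X1 phi /\ cL1 phi /\ is_trace T (cintegral phi).
Proof.
move=> philoc TQ tT; split; first exact: X1_phi philoc TQ tT.
split; first exact: cL1_phi philoc TQ tT.
exact: is_trace_phi philoc TQ tT.
Qed.
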